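(* Let $p\ge1$, $q>0$ and $s>\max\{0,1-\frac qn\}$. Then: (1) If $\beta>0$, then $M(\Lambda_\beta,\mathcal{N}(p,q,s))=\mathcal{N}(p,q,s)$. (2) If $\beta=0$, then $M(\Lambda_\beta,\mathcal{N}(p,q,s))\subseteq\mathcal{N}(p,q,s)$. Conversely, if $\varphi\in H(\mathbb{B})$ satisfies $$\sup_{a\in\mathbb{B}}\int_{\mathbb{B}}|\varphi(z)|^p\left(\log\frac2{1-|z|^2}\right)^{p}(1-|z|^2)^q(1-|\Phi_a(z)|^2)^{ns}d\lambda(z)<\infty,$$ then $\varphi\in M(\Lambda_\beta,\mathcal{N}(p,q,s))$.
   Context: $\mathbb{B}$ is the open unit ball of $\mathbb{C}^n$, $H(\mathbb{B})$ is the space of holomorphic functions on $\mathbb{B}$, $dV$ is normalized volume measure on $\mathbb{B}$, and $d\lambda(z)=\frac{dV(z)}{(1-|z|^2)^{n+1}}$. For $a\in\mathbb{B}$, $\Phi_a(z)=\frac{a-P_az-s_aQ_az}{1-\langle z,a\rangle}$, where $s_a=\sqrt{1-|a|^2}$, $P_a$ is the orthogonal projection onto the span of $a$ and $Q_a=I-P_a$. For $p,q,s>0$, $\mathcal{N}(p,q,s)$ is the set of $f\in H(\mathbb{B})$ with $\sup_{a\in\mathbb{B}}\int_{\mathbb{B}}|f(z)|^p(1-|z|^2)^q(1-|\Phi_a(z)|^2)^{ns}d\lambda(z)<\infty$. $Rf(z)=\sum_{k=1}^nz_k\frac{\partial f}{\partial z_k}(z)$ and $R^k$ is its $k$-th iterate.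 For $\beta\in\mathbb{R}$, let $k$ be the smallest nonnegative integer greater than $\beta$; the holomorphic Lipschitz space $\Lambda_\beta$ is the set of $f\in H(\mathbb{B})$ with $|f(0)|+\sup_{z\in\mathbb{B}}(1-|z|^2)^{k-\beta}|R^kf(z)|<\infty$. For spaces $X,Y$ of holomorphic functions on $\mathbb{B}$, $M(X,Y)$ is the set of $\varphi\in H(\mathbb{B})$ with $\varphi f\in Y$ for all $f\in X$. *)

(* Defs.v *)
From HB Require Import structures.
From mathcomp Require Import all_boot all_order all_algebra.
From mathcomp Require Import spectral complex.
From mathcomp Require Import all_classical all_reals all_analysis.

Set Implicit Arguments.
Unset Strict Implicit.
Unset Printing Implicit Defensive.

Import Order.TTheory GRing.Theory Num.Theory.
Import numFieldNormedType.Exports.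
Import ComplexField.Normc.

Local Open Scope classical_set_scope.
Local Open Scope ring_scope.

(* R[i] has no topology of its own in the library; give it the one of the
   numFieldType R[i]^o, so that [differentiable] and ['D_v] below are the
   complex notions. *)
HB.instance Definition _ (R : realType) :=
  PseudoPointedMetric.copy R[i] (R[i]^o).
HB.instance Definition _ (R : realType) := NormedModule.copy R[i] (R[i]^o).

(** * The n-fold product of a sigma-finite measure *)

Section tuple_measure.
Context {d : measure_display} {T : measurableType d} {R : realType}.
Variable mu : {sigma_finite_measure set T -> \bar R}.

Section step.
Variables (n : nat) (nu : {sigma_finite_measure set (n.-tuple T) -> \bar R}).

Definition cons_pair (p : T * n.-tuple T) : n.+1.-tuple T :=
  [the n.+1.-tuple T of p.1 :: p.2].

Let mcons : measurable_fun [set: T * n.-tuple T] cons_pair.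
Proof. exact: measurable_cons. Qed.

Definition tuple_measure_step : set (n.+1.-tuple T) -> \bar R :=
  pushforward (mu \x nu)%E cons_pair.

Let step0 : tuple_measure_step set0 = 0%E.
Proof. exact: measure0. Qed.

Let step_ge0 A : (0 <= tuple_measure_step A)%E.
Proof. exact: measure_ge0. Qed.

Let step_sigma_additive : semi_sigma_additive tuple_measure_step.
Proof. exact: measure_semi_sigma_additive. Qed.

HB.instance Definition _ := isMeasure.Build _ _ _ tuple_measure_step
  step0 step_ge0 step_sigma_additive.

Let uncons (t : n.+1.-tuple T) : T * n.-tuple T :=
  (thead t, [tuple of behead t]).

Let muncons : measurable_fun [set: n.+1.-tuple T] uncons.
Proof.
by apply/measurable_fun_pair; [exact: measurable_tnth|exact: measurable_behead].
Qed.

Let step_sigma_finite : sigma_finite setT tuple_measure_step.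
Proof.
have /sigma_finiteP[F [TF ndF Foo]] := sigma_finiteT mu.
have /sigma_finiteP[G [TG ndG Goo]] := sigma_finiteT nu.
exists (fun k => uncons @^-1` (F k `*` G k)).
  apply/esym/seteqP; split=> // t _.
  have [[i _ Fi] [j _ Gj]] : (\bigcup_i F i) (uncons t).1 /\
      (\bigcup_i G i) (uncons t).2 by rewrite -TF -TG.
  exists (maxn i j) => //; split.
  - by apply: (subsetPset _ _ (ndF _ _ (leq_maxl i j))).
  - by apply: (subsetPset _ _ (ndG _ _ (leq_maxr i j))).
move=> k; have [mF Fk] := Foo k; have [mG Gk] := Goo k; split.
  by rewrite -[X in measurable X]setTI; apply: muncons => //; exact: measurableX.
rewrite /tuple_measure_step /pushforward -comp_preimage.
rewrite (_ : uncons \o _ = id); last first.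
  apply/funext => -[x t] /=; congr pair; exact/val_inj.
by rewrite preimage_id product_measure1E// lte_mul_pinfty// ge0_fin_numE.
Qed.

HB.instance Definition _ := Measure_isSigmaFinite.Build _ _ _
  tuple_measure_step step_sigma_finite.

End step.

Fixpoint tuple_measure n : {sigma_finite_measure set (n.-tuple T) -> \bar R} :=
  if n is m.+1 then tuple_measure_step (tuple_measure m)
  else \d_([tuple] : 0.-tuple T).

Lemma tuple_measure_box n (A : 'I_n -> set T) :
  (forall i, measurable (A i)) ->
  tuple_measure n [set t | forall i, A i (tnth t i)] = (\prod_(i < n) mu (A i))%E.
Proof.
elim: n A => [A _|n IHn A mA].
  rewrite big_ord0 /= diracE (_ : _ \in _ = true)//.
  by apply/mem_set => i; have := ltn_ord i; rewrite ltn0.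
rewrite big_ord_recl -IHn//= /tuple_measure_step /pushforward.
rewrite -product_measure1E//; last first.
  rewrite (_ : mkset _ = \bigcap_(i in [set: 'I_n])
    ((fun t : n.-tuple T => tnth t i) @^-1` A (lift ord0 i))); last first.
    by apply/seteqP; split => [t + i _|t + i]; exact.
  apply: fin_bigcap_measurable => // i _.
  by rewrite -[X in measurable X]setTI; exact: measurable_tnth.
congr (_ _); apply/seteqP; split => [[x t] /= H|[x t] /= [Hx Ht] i].
  split; first by have := H ord0.
  by move=> i; have := H (lift ord0 i); rewrite /= tnthS.
by have [j ->|->//] := unliftP ord0 i; rewrite tnthS.
Qed.

End tuple_measure.

(** * C^n with its volume measure *)

Definition Cspace (R : realType) (n : nat) := 'rV[R[i]]_n.

Section volume.
Context {R : realType} {n : nat}.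

(* R^(2n) is identified with C^n; C^n carries the image of the product
   sigma-algebra of R^(2n), that is, the Borel sets. *)
Definition Cvec (t : (n + n).-tuple (measurableTypeR R)) : Cspace R n :=
  \row_j (tnth t (lshift n j) +i* tnth t (rshift n j))%C.

Definition Cspace_measurable (A : set (Cspace R n)) : Prop :=
  measurable (Cvec @^-1` A).

Let Cmeasurable0 : Cspace_measurable set0.
Proof. by rewrite /Cspace_measurable preimage_set0. Qed.

Let CmeasurableC A : Cspace_measurable A -> Cspace_measurable (~` A).
Proof. by rewrite /Cspace_measurable preimage_setC => /measurableC. Qed.

Let Cmeasurable_bigcup (F : (set (Cspace R n))^nat) :
  (forall i, Cspace_measurable (F i)) -> Cspace_measurable (\bigcup_i F i).
Proof.
by move=> mF; rewrite /Cspace_measurable preimage_bigcup; exact: bigcupT_measurable.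
Qed.

HB.instance Definition _ := Pointed.on (Cspace R n).
HB.instance Definition _ := @isMeasurable.Build default_measure_display
  (Cspace R n) Cspace_measurable Cmeasurable0 CmeasurableC Cmeasurable_bigcup.

Let mCvec : measurable_fun [set: (n + n).-tuple (measurableTypeR R)] Cvec.
Proof. by move=> _ A mA; rewrite setTI. Qed.

Definition Cvol : set (Cspace R n) -> \bar R :=
  pushforward (tuple_measure (@lebesgue_measure R) (n + n)) Cvec.

Let Cvol0 : Cvol set0 = 0%E. Proof. exact: measure0. Qed.

Let Cvol_ge0 A : (0 <= Cvol A)%E. Proof. exact: measure_ge0. Qed.

Let Cvol_sigma_additive : semi_sigma_additive Cvol.
Proof. exact: measure_semi_sigma_additive. Qed.

HB.instance Definition _ := isMeasure.Build _ _ _ Cvol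
  Cvol0 Cvol_ge0 Cvol_sigma_additive.

End volume.

Section ball.
Context {R : realType} {n : nat}.
Implicit Types (a z : 'rV[R[i]]_n) (f : 'rV[R[i]]_n -> R[i]).

Definition sqnorm z : R := \sum_(i < n) normc (z 0 i) ^+ 2.

Definition unit_ball : set ('rV[R[i]]_n) := [set z | sqnorm z < 1].

Let inv_vol_ge0 : 0 <= (fine (Cvol unit_ball))^-1.
Proof. by rewrite invr_ge0 fine_ge0. Qed.

Definition dV : {measure set (Cspace R n) -> \bar R} :=
  mscale (NngNum inv_vol_ge0) Cvol.

Lemma sqnorm_Cvec (t : (n + n).-tuple (measurableTypeR R)) :
  sqnorm (Cvec t) = \sum_(i < n + n) tnth t i ^+ 2.
Proof.
rewrite [RHS]big_split_ord -[RHS]big_split; apply: eq_bigr => j _.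
by rewrite mxE /= sqr_sqrtr// addr_ge0// sqr_ge0.
Qed.

Lemma measurable_unit_ball : measurable (unit_ball : set (Cspace R n)).
Proof.
suff: measurable ((@Cvec R n) @^-1` unit_ball) by [].
pose g (t : (n + n).-tuple (measurableTypeR R)) : R :=
  \sum_(i < n + n) tnth t i ^+ 2.
rewrite (_ : _ @^-1` _ = g @^-1` `]-oo, 1[); last first.
  apply/seteqP; split=> t /=; rewrite in_itv/= /unit_ball/= sqnorm_Cvec//.
rewrite -[X in measurable X]setTI.
have mg : measurable_fun setT g.
  rewrite /g; apply: measurable_sum => i.
  by apply: measurable_realfun.measurable_funX; exact: measurable_tnth.
exact: mg.
Qed.

Let box (r : R) : set ((n + n).-tuple (measurableTypeR R)) :=
  [set t | forall i, `[- r, r]%classic (tnth t i)].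

Let mbox r : measurable (box r).
Proof.
rewrite (_ : box r = \bigcap_(i in [set: 'I_(n + n)])
    ((fun t : (n + n).-tuple (measurableTypeR R) => tnth t i) @^-1` `[- r, r])).
  apply: fin_bigcap_measurable => // i _.
  rewrite -[X in measurable X]setTI; apply: measurable_tnth => //.
by apply/seteqP; split => [t + i _|t + i]; exact.
Qed.

Let tuple_measure_cube (r : R) : 0 < r ->
  tuple_measure (@lebesgue_measure R) (n + n) (box r) =
  ((r + r) ^+ (n + n))%:E.
Proof.
move=> r0; have -> := tuple_measure_box (@lebesgue_measure R)
  (A := fun=> `[- r, r]%classic) (fun i : 'I_(n + n) => measurable_itv _).
rewrite (eq_bigr (fun=> (r + r)%:E)) => [|i _].
  by rewrite prodEFin prodr_const card_ord.
by rewrite [LHS]lebesgue_measure_itv/= lte_fin gtrN// -EFinB opprK.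
Qed.

Let mCball : measurable ((@Cvec R n) @^-1` unit_ball).
Proof. exact: measurable_unit_ball. Qed.

Lemma Cvol_unit_ball : (0 < Cvol (unit_ball : set (Cspace R n)) < +oo)%E.
Proof.
apply/andP; split.
  pose e : R := (n + n).+1%:R^-1.
  have e0 : 0 < e by rewrite invr_gt0.
  apply: (@lt_le_trans _ _ (tuple_measure (@lebesgue_measure R) (n + n) (box e))).
    by rewrite tuple_measure_cube// lte_fin exprn_gt0// addr_gt0.
  apply: le_measure; rewrite ?inE//.
  move=> t bt; rewrite /unit_ball /= sqnorm_Cvec.
  apply: (@le_lt_trans _ _ (\sum_(i < n + n) e)).
    apply: (@ler_sum R _ _ _ (fun i => (tnth t i : R) ^+ 2)) => i _.
    have := bt i; rewrite /= in_itv/= -ler_norml => te.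
    rewrite -real_normK ?num_real// (le_trans (_ : _ <= e ^+ 2))//.
      by rewrite ler_sqr ?nnegrE// ltW.
    by rewrite expr2 ler_piMl ?(ltW e0)// invf_le1// ler1n.
  by rewrite sumr_const card_ord -[ltLHS]mulr_natl ltr_pdivrMr// mul1r ltr_nat.
apply: (@le_lt_trans _ _ (tuple_measure (@lebesgue_measure R) (n + n) (box 1))).
  apply: (@le_measure _ _ _ (tuple_measure (@lebesgue_measure R) (n + n)));
    rewrite ?inE//.
  move=> t; rewrite /unit_ball /= sqnorm_Cvec => t1 i.
  rewrite /= in_itv/= -ler_norml -(@expr_le1 _ 2)// real_normK ?num_real//.
  apply: le_trans (ltW t1); rewrite (bigD1 i)//= lerDl sumr_ge0// => j _.
  exact: sqr_ge0.
by rewrite tuple_measure_cube// ltry.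
Qed.

Lemma dV_unit_ball : dV (unit_ball : set (Cspace R n)) = 1%E.
Proof.
have /andP[v0 vy] := Cvol_unit_ball.
rewrite /dV /= /mscale/=.
rewrite -[X in (_ * X)%E]fineK ?ge0_fin_numE ?(ltW v0)//.
by rewrite -EFinM mulVf// gt_eqF// fine_gt0// v0.
Qed.

Definition integral_dlambda (g : 'rV[R[i]]_n -> R) : \bar R :=
  (\int[dV]_(z in unit_ball) (g z / (1 - sqnorm z) ^+ n.+1)%R%:E)%E.

(* [dotmx z a] is the sum of the z_i * conj(a_i); matrices act on row vectors
   from the right, and [proj_ortho 0 = 0]. *)
Definition Phi a z : 'rV[R[i]]_n :=
  let s_a := ((Num.sqrt (1 - sqnorm a))%:C)%C in
  let P_a_z := z *m proj_ortho a in
  let Q_a_z := z - P_a_z in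
  (1 - dotmx z a)^-1 *: (a - P_a_z - s_a *: Q_a_z).

(* Functions on the ball are represented by total functions, of which only the
   values on the (open) unit ball matter in all that follows. *)
Definition holomorphic : set ('rV[R[i]]_n -> R[i]) :=
  [set f | forall z, unit_ball z -> differentiable f z].

Definition Rderiv f : 'rV[R[i]]_n -> R[i] :=
  fun z => \sum_(k < n) z 0 k * 'D_('e_k) f z.

(* The quantity defining N(p,q,s) when g = |f|^p. *)
Definition Nsup (q s : R) (g : 'rV[R[i]]_n -> R) : \bar R :=
  ereal_sup [set integral_dlambda (fun z =>
    g z * (1 - sqnorm z) `^ q * (1 - sqnorm (Phi a z)) `^ (n%:R * s))
  | a in unit_ball].

Definition spaceN (p q s : R) : set ('rV[R[i]]_n -> R[i]) :=
  [set f | holomorphic f /\ (Nsup q s (fun z => (normc (f z) `^ p)%R) < +oo)%E].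

Lemma ex_nat_gt (beta : R) : exists k : nat, beta < k%:R.
Proof. by exists (Num.truncn beta).+1; exact: truncnS_gt. Qed.

Definition Lip_order (beta : R) : nat := ex_minn (ex_nat_gt beta).

Definition spaceLip (beta : R) : set ('rV[R[i]]_n -> R[i]) :=
  let k := Lip_order beta in
  [set f | holomorphic f /\
    ((normc (f 0))%:E +
     ereal_sup [set ((1 - sqnorm z) `^ (k%:R - beta) *
                     normc (iter k Rderiv f z))%R%:E | z in unit_ball]
     < +oo)%E].

Definition multipliers (X Y : set ('rV[R[i]]_n -> R[i])) :
    set ('rV[R[i]]_n -> R[i]) :=
  [set phi | holomorphic phi /\ forall f, X f -> Y (fun z => phi z * f z)].

End ball.

(* Main.v *)
Require Import Defs.
From HB Require Import structures.
From mathcomp Require Import all_boot all_order all_algebra.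
From mathcomp Require Import complex ring lra.
From mathcomp Require Import all_classical all_reals all_analysis.

(** A multiplier from [spaceLip beta] to [spaceN p q s] belongs to [spaceN p q s]
    because the constant function 1 belongs to every Lipschitz space with
    [0 <= beta] ([one_in_spaceLip]).  Conversely, the integrals that define
    [spaceN] only see the modulus of a function, so that it suffices to know how
    fast a Lipschitz function can grow: it is bounded when [0 < beta]
    ([spaceLip_bounded]), and it is O(log (2 / (1 - |z|^2))) when [beta = 0]
    ([spaceLip0_log_growth]).  The product [phi * f] is then dominated pointwise,
    and so are the integrals ([spaceN_mul_dominated]).

    The growth of f is found by integrating along rays.  The derivative of
    t |-> h(tz) is Rh(tz) / t, so that |Rh(z)| <= C (1 - |z|)^(-c) makes h bounded
    if c < 1, and O(log (1 / (1 - |z|))) if c = 1 ([radial_growth]).  For f in the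
    Lipschitz space and k its order, this applies to h = R^(k-1) f with
    c = k - beta, which lies in ]0, 1].  If k > 1, applying it again to
    R^(k-2) f, ..., f, each time with the bound just obtained, leads to f; the
    logarithm of the case c = 1 is absorbed in the power c = 1/2.

    This descent needs R^j f to be complex differentiable, while [holomorphic]
    only says that f itself is differentiable at each point.  So the analytic
    core is the regularity theorem [diff_differentiable], in an arbitrary complex
    normed space.  It rests on Goursat's theorem for rectangles ([goursat]),
    proved by bisection.  If phi is differentiable on a disc and vanishes at the
    centre 0, the function w |-> phi(e^w) e^(-w) is 2 pi i-periodic, hence
    Goursat's theorem on [x1, x2] x [0, 2 pi] shows that its integral over the
    vertical side does not depend on x; letting x tend to -oo identifies it as
    2 pi phi'(0) ([cauchy_derivative]).  On complex lines, this formula bounds the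
    differential of f ([cauchy_estimate]), so that f is Lipschitz; inserting this
    in the formula, the differential is Lipschitz ([diff_lipschitz]), so that the
    first Taylor remainder of f is quadratic ([taylor_first]); inserting this in
    the formula once more differentiates it under the integral sign. *)

Set Implicit Arguments.
Unset Strict Implicit.
Unset Printing Implicit Defensive.

Import Order.TTheory GRing.Theory Num.Theory.
Import numFieldNormedType.Exports.
Import ComplexField.Normc.

Local Open Scope classical_set_scope.
Local Open Scope ring_scope.

(** * The modulus and integrals of complex functions of a real variable *)

Section modulus.
Context {R : realType}.
Implicit Types x y z : R[i].

Lemma normc_ge0 x : 0 <= normc x.
Proof. by case: x => a b; exact: sqrtr_ge0. Qed.

Lemma normcD x y : normc (x + y) <= normc x + normc y.
Proof. exact: le_normcD. Qed.

Lemma normc_opp x : normc (- x) = normc x.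
Proof. exact: normcN. Qed.

Lemma normcB x y : normc (x - y) <= normc x + normc y.
Proof. by rewrite (le_trans (normcD _ _))// normc_opp. Qed.

Lemma normc_distC x y : normc (x - y) = normc (y - x).
Proof. by rewrite -opprB normc_opp. Qed.

Lemma normc_le0 x : (normc x <= 0) = (x == 0).
Proof.
apply/idP/eqP => [x0|->]; last by rewrite (normc0 R).
by apply: eq0_normc; apply/eqP; rewrite eq_le x0 normc_ge0.
Qed.

Lemma normc_real (r : R) : normc r%:C%C = `|r|.
Proof. by rewrite /= expr0n/= addr0 sqrtr_sqr. Qed.

Lemma normc_i (r : R) : normc (Complex 0 r) = `|r|.
Proof. by rewrite /= expr0n/= add0r sqrtr_sqr. Qed.

Lemma abs_Re_le x : `|complex.Re x| <= normc x.
Proof.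
case: x => a b /=; rewrite -sqrtr_sqr ler_wsqrtr//.
by rewrite lerDl sqr_ge0.
Qed.

Lemma abs_Im_le x : `|complex.Im x| <= normc x.
Proof.
case: x => a b /=; rewrite -sqrtr_sqr ler_wsqrtr//.
by rewrite lerDr sqr_ge0.
Qed.

Lemma ReM x y : complex.Re (x * y) =
  complex.Re x * complex.Re y - complex.Im x * complex.Im y.
Proof. by case: x y => a b [c d]. Qed.

Lemma ImM x y : complex.Im (x * y) =
  complex.Re x * complex.Im y + complex.Im x * complex.Re y.
Proof. by case: x y => a b [c d]. Qed.

Lemma normc_le_ReIm x : normc x <= `|complex.Re x| + `|complex.Im x|.
Proof.
rewrite [in leLHS](complexE x) (le_trans (normcD _ _))// normcM.
by rewrite normc_i normr1 mul1r !normc_real.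
Qed.

End modulus.

Section cint.
Context {R : realType}.
Notation mu := (@lebesgue_measure R).
Implicit Types (h k : R -> R[i]) (a b m : R) (c : R[i]).

Definition cint a b h : R[i] := Complex
  (\int[mu]_(t in `[a, b]) complex.Re (h t))%R
  (\int[mu]_(t in `[a, b]) complex.Im (h t))%R.

Definition cintegrable a b h :=
  mu.-integrable `[a, b] (EFin \o (fun t => complex.Re (h t))) /\
  mu.-integrable `[a, b] (EFin \o (fun t => complex.Im (h t))).

Definition ccontinuous h (t : R) := forall e : R, 0 < e ->
  exists2 d : R, 0 < d & forall u, `|u - t| < d -> normc (h u - h t) <= e.

(** Integrability is the only property of the integrand that the rules below use;
    continuity is what provides it. *)
Lemma ccontinuous_integrable a b h :
  (forall t, a <= t <= b -> ccontinuous h t) -> cintegrable a b h.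
Proof.
have aux (f : R -> R) : (forall t, a <= t <= b -> {for t, continuous f}) ->
    mu.-integrable `[a, b] (EFin \o f).
  move=> cf; apply: continuous_compact_integrable; first exact: segment_compact.
  apply: continuous_in_subspaceT => t; rewrite inE/= in_itv/=; exact: cf.
move=> ch; split; apply: aux => t /ch cht; apply/cvgrPdist_le => /= e e0;
  have [d d0 H] := cht e e0; near=> u;
  (have ud : `|u - t| < d by near: u; apply/nbhs_ballP; exists d => //= v;
     rewrite /ball/= distrC);
  rewrite distrC; apply: le_trans (H _ ud).
- by rewrite (le_trans _ (abs_Re_le _))// raddfB.
- by rewrite (le_trans _ (abs_Im_le _))// raddfB.
Unshelve. all: by end_near. Qed.

Lemma eq_cint a b h k : (forall t, a <= t <= b -> h t = k t) ->
  cint a b h = cint a b k.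
Proof.
move=> hk; congr Complex; apply: eq_Rintegral => t;
by rewrite inE/= in_itv/= => /hk ->.
Qed.

Lemma cintegrableD a b h k : cintegrable a b h -> cintegrable a b k ->
  cintegrable a b (fun t => h t + k t).
Proof.
move=> [h1 h2] [k1 k2]; split.
- rewrite (_ : _ \o _ = (EFin \o (fun t => complex.Re (h t))) \+
    (EFin \o (fun t => complex.Re (k t))))%E.
    exact: integrableD.
  by apply/funext => t /=; rewrite raddfD.
- rewrite (_ : _ \o _ = (EFin \o (fun t => complex.Im (h t))) \+
    (EFin \o (fun t => complex.Im (k t))))%E.
    exact: integrableD.
  by apply/funext => t /=; rewrite raddfD.
Qed.

Lemma cintD a b h k : cintegrable a b h -> cintegrable a b k ->
  cint a b (fun t => h t + k t) = cint a b h + cint a b k.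
Proof.
move=> [h1 h2] [k1 k2]; apply/eqP; rewrite eq_complex/= -!RintegralD//=.
under eq_Rintegral do rewrite raddfD.
under [X in _ && (X == _)]eq_Rintegral do rewrite raddfD.
by rewrite !eqxx.
Qed.

Lemma cintegrableZ a b h c : cintegrable a b h ->
  cintegrable a b (fun t => c * h t).
Proof.
move=> [h1 h2]; split.
- rewrite (_ : _ \o _ =
     (fun t => (complex.Re c)%:E * (EFin \o (fun t => complex.Re (h t))) t) \+
     (fun t => (- complex.Im c)%:E * (EFin \o (fun t => complex.Im (h t))) t))%E.
    by apply: integrableD => //; exact: integrableZl.
  by apply/funext => t /=; rewrite -!EFinM -EFinD ReM mulNr.
- rewrite (_ : _ \o _ =
     (fun t => (complex.Re c)%:E * (EFin \o (fun t => complex.Im (h t))) t) \+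
     (fun t => (complex.Im c)%:E * (EFin \o (fun t => complex.Re (h t))) t))%E.
    by apply: integrableD => //; exact: integrableZl.
  by apply/funext => t /=; rewrite -!EFinM -EFinD ImM.
Qed.

Lemma cintZ a b h c : cintegrable a b h ->
  cint a b (fun t => c * h t) = c * cint a b h.
Proof.
move=> [h1 h2]; rewrite /cint.
have i1 (r : R) : mu.-integrable `[a, b] (EFin \o (fun t => r * complex.Re (h t))).
  exact: (integrableZl _ r h1).
have i2 (r : R) : mu.-integrable `[a, b] (EFin \o (fun t => r * complex.Im (h t))).
  exact: (integrableZl _ r h2).
case: c => x y; apply/eqP; rewrite eq_complex/=; apply/andP; split; apply/eqP.
- rewrite -(RintegralZl (mu := mu) x)// -(RintegralZl (mu := mu) y)//.
  rewrite -RintegralB//; apply: eq_Rintegral => t _.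
  by case: (h t).
- rewrite -(RintegralZl (mu := mu) x)// -(RintegralZl (mu := mu) y)//.
  rewrite -RintegralD//; apply: eq_Rintegral => t _.
  by case: (h t).
Qed.

Lemma cint_split a m b h : a <= m -> m <= b -> cintegrable a b h ->
  cint a b h = cint a m h + cint m b h.
Proof.
move=> am mb [h1 h2].
have H f : mu.-integrable `[a, b] (EFin \o f) ->
    \int[mu]_(t in `[a, b]) f t =
    \int[mu]_(t in `[a, m]) f t + \int[mu]_(t in `[m, b]) f t.
  move=> fi; apply/eqP; rewrite addrC -subr_eq; apply/eqP.
  rewrite Rintegral_itvB ?bnd_simp// Rintegral_itv_obnd_cbnd//.
  apply: integrableS fi => //.
  by apply: subset_itvr; rewrite bnd_simp.
by apply/eqP; rewrite eq_complex/= -!H// !eqxx.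
Qed.

Lemma cintegrableB a b (h k : R -> R[i]) : cintegrable a b h -> cintegrable a b k ->
  cintegrable a b (fun t => h t - k t).
Proof.
move=> ih ik; have := cintegrableD ih (cintegrableZ (-1) ik).
by under [X in cintegrable _ _ X -> _]funext do rewrite mulN1r.
Qed.

Lemma cintegrable_cst a b (z : R[i]) : cintegrable a b (fun=> z).
Proof.
apply: ccontinuous_integrable => t _ e e0; exists 1 => // u _.
by rewrite subrr (normc0 R) ltW.
Qed.

Lemma cintegrableS a b a' b' h : a <= a' -> b' <= b -> cintegrable a b h ->
  cintegrable a' b' h.
Proof.
move=> aa bb [h1 h2]; split.
- by apply: integrableS h1 => //; apply: subset_itv; rewrite bnd_simp.
- by apply: integrableS h2 => //; apply: subset_itv; rewrite bnd_simp.
Qed.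

Lemma cint_cst a b c : a <= b -> cint a b (fun=> c) = (b - a)%:C%C * c.
Proof.
rewrite le_eqVlt => ab; case: c => x y; apply/eqP; rewrite eq_complex/=.
rewrite !Rintegral_cst//= lebesgue_measure_itv/= lte_fin.
case/predU1P : ab => [->|->/=].
  by rewrite ltxx subrr/= !mulr0 !mul0r subrr addr0 !eqxx.
by rewrite !mul0r subr0 addr0 ![_ * (b - a)]mulrC !eqxx.
Qed.

(** The factor 2 comes from bounding the real and the imaginary part separately. *)
Lemma cint_bound a b h M : a <= b -> cintegrable a b h ->
  (forall t, a <= t <= b -> normc (h t) <= M) ->
  normc (cint a b h) <= 2 * (M * (b - a)).
Proof.
move=> ab [h1 h2] hM.
have H f : mu.-integrable `[a, b] (EFin \o f) ->
    (forall t, a <= t <= b -> `|f t| <= M) ->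
    `|\int[mu]_(t in `[a, b]) f t| <= M * (b - a).
  move=> fi fM; apply: (le_trans (le_normr_Rintegral _ fi)) => //.
  have -> : M * (b - a) = \int[mu]_(t in `[a, b]) (cst M t).
    rewrite Rintegral_cst//= lebesgue_measure_itv/= lte_fin.
    by move: ab; rewrite le_eqVlt => /predU1P[->|->//]; rewrite ltxx subrr.
  apply: le_Rintegral => //.
  - exact: (integrable_norm fi).
  - apply: continuous_compact_integrable; first exact: segment_compact.
    by apply: continuous_subspaceT => t; exact: cvg_cst.
apply: (le_trans (normc_le_ReIm _)); rewrite mulr_natl mulr2n; apply: lerD => /=.
- by apply: H => // t /hM; apply: le_trans; exact: abs_Re_le.
- by apply: H => // t /hM; apply: le_trans; exact: abs_Im_le.
Qed.

End cint.

(** * Goursat's theorem for rectangles *)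

Section goursat.
Context {R : realType}.
Implicit Types (g : R -> R -> R[i]) (a b c d x y w h : R).

Lemma nested_segments (u v : nat -> R) : (forall k, u k <= u k.+1) ->
  (forall k, v k.+1 <= v k) -> (forall k, u k <= v k) ->
  exists x, forall k, u k <= x <= v k.
Proof.
move=> ndu niv uv.
have uj : {homo u : i j / (i <= j)%N >-> i <= j} by exact: homo_leq le_trans ndu.
have vj : {homo v : i j / (i <= j)%N >-> j <= i}.
  by apply: (@homo_leq _ v (fun x y => y <= x)) => // x y z zx yz; exact: le_trans yz zx.
have ub k : ubound (range u) (v k).
  move=> _ [j _ <-]; rewrite (le_trans (uj _ _ (leq_maxl j k)))//.
  by rewrite (le_trans (uv _))// vj// leq_maxr.
have us : has_sup (range u) by split; [exists (u 0%N), 0%N|exists (v 0%N); exact: ub].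
exists (sup (range u)) => k; apply/andP; split.
  by apply: sup_upper_bound => //; exists k.
by apply: ge_sup (ub k); exists (u 0%N), 0%N.
Qed.

Lemma exists_halving_lt (w e : R) : 0 < e -> exists k, w / 2 ^+ k < e.
Proof.
move=> e0; exists (Num.truncn (w / e)).+1.
rewrite ltr_pdivrMr ?exprn_gt0// -ltr_pdivrMl// mulrC.
rewrite (lt_trans (truncnS_gt _))// -natrX ltr_nat.
exact: ltn_expl.
Qed.

(** Complex differentiability at x + iy of a function of the two real coordinates:
    A is the complex derivative. *)
Definition cdiff2 g x y := exists A : R[i], forall e : R, 0 < e ->
  exists2 r : R, 0 < r & forall x' y', `|x' - x| < r -> `|y' - y| < r ->
    normc (g x' y' - g x y - A * Complex (x' - x) (y' - y)) <=
    e * (`|x' - x| + `|y' - y|).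

Lemma cdiff2_continuous g x y : cdiff2 g x y ->
  ccontinuous (g^~ y) x /\ ccontinuous (g x) y.
Proof.
move=> [A /(_ 1 ltr01)[r r0 H]].
have A0 : 0 < 1 + normc A by rewrite ltr_pwDl ?normc_ge0.
split=> e e0; exists (Num.min r (e / (1 + normc A))) => [|t];
    rewrite ?lt_min ?r0 ?divr_gt0// => /andP[tr te].
- have := H t y tr; rewrite subrr normr0 => /(_ r0); rewrite addr0 mul1r => K.
  rewrite -[_ - _](subrK (A * Complex (t - x) 0)).
  rewrite (le_trans (normcD _ _))// (le_trans (lerD K (lexx _)))//.
  rewrite normcM (_ : normc (Complex _ _) = `|t - x|); last exact: normc_real.
  by rewrite -{1}[`|_|]mul1r -mulrDl -ler_pdivlMl// mulrC ltW.
- have := H x t; rewrite subrr normr0 => /(_ r0 tr); rewrite add0r mul1r => K.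
  rewrite -[_ - _](subrK (A * Complex 0 (t - y))).
  rewrite (le_trans (normcD _ _))// (le_trans (lerD K (lexx _)))//.
  rewrite normcM normc_i.
  by rewrite -{1}[`|_|]mul1r -mulrDl -ler_pdivlMl// mulrC ltW.
Qed.

(** The contour integral along the boundary of [a, b] x [c, d], in which opposite
    sides are paired.  For an affine g both integrands are then constants, whose
    contributions cancel. *)
Definition rint g a b c d : R[i] :=
  cint a b (fun x => g x c - g x d) +
  Complex 0 1 * cint c d (fun y => g b y - g a y).

Definition rintegrable g a b c d :=
  (forall y, c <= y <= d -> cintegrable a b (g^~ y)) /\
  (forall x, a <= x <= b -> cintegrable c d (g x)).

Lemma rintegrableS g a b c d a' b' c' d' : a <= a' -> b' <= b ->
  c <= c' -> d' <= d -> rintegrable g a b c d -> rintegrable g a' b' c' d'.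
Proof.
move=> aa bb cc dd [ix iy]; split=> [y|x] /andP[h1 h2].
  by apply: cintegrableS (ix y _) => //; lra.
by apply: cintegrableS (iy x _) => //; lra.
Qed.

Lemma rint_splitx g a m b c d : a <= m -> m <= b -> c <= d ->
  rintegrable g a b c d ->
  rint g a b c d = rint g a m c d + rint g m b c d.
Proof.
move=> am mb cd [ix iy]; rewrite /rint (cint_split am mb); last first.
  by apply: cintegrableB; apply: ix; lra.
rewrite (@eq_cint _ c d _ (fun y => (g m y - g a y) + (g b y - g m y))).
  rewrite [cint c d _]cintD; try by apply: cintegrableB; apply: iy; lra.
  ring.
by move=> t _; ring.
Qed.

Lemma rint_splity g a b c m d : a <= b -> c <= m -> m <= d ->
  rintegrable g a b c d ->
  rint g a b c d = rint g a b c m + rint g a b m d.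
Proof.
move=> ab cm md [ix iy]; rewrite /rint (cint_split cm md); last first.
  by apply: cintegrableB; apply: iy; lra.
rewrite (@eq_cint _ a b _ (fun x => (g x c - g x m) + (g x m - g x d))).
  rewrite [cint a b _]cintD; try by apply: cintegrableB; apply: ix; lra.
  ring.
by move=> t _; ring.
Qed.

(** The affine part of g contributes nothing, hence only the distance M of g to
    an affine function of x + iy matters. *)
Lemma rint_affine_bound g a b c d x y (A : R[i]) M : a <= b -> c <= d ->
  rintegrable g a b c d ->
  (forall x' y', a <= x' <= b -> c <= y' <= d ->
    normc (g x' y' - g x y - A * Complex (x' - x) (y' - y)) <= M) ->
  normc (rint g a b c d) <= 4 * M * ((b - a) + (d - c)).
Proof.
move=> ab cd [ix iy] H.
(* The values of the two integrands for the affine function. *)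
pose K1 : R[i] := A * Complex 0 (c - d).
pose K2 : R[i] := A * Complex (b - a) 0.
pose r1 := fun x => (g x c - g x d) - K1.
pose r2 := fun y => (g b y - g a y) - K2.
have i1 : cintegrable a b r1.
  apply: cintegrableB; last exact: cintegrable_cst.
  by apply: cintegrableB; apply: ix; lra.
have i2 : cintegrable c d r2.
  apply: cintegrableB; last exact: cintegrable_cst.
  by apply: cintegrableB; apply: iy; lra.
have -> : rint g a b c d = cint a b r1 + Complex 0 1 * cint c d r2.
  rewrite /rint (@eq_cint _ a b _ (fun x => r1 x + K1)); last first.
    by move=> t _; rewrite subrK.
  rewrite (@eq_cint _ c d _ (fun x => r2 x + K2)); last first.
    by move=> t _; rewrite subrK.
  rewrite (cintD i1 (cintegrable_cst _ _ K1)) (cintD i2 (cintegrable_cst _ _ K2)).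
  rewrite !cint_cst// mulrDr addrACA -[RHS]addr0; congr (_ + _).
  rewrite /K1 /K2; case: A {H K1 K2 r1 r2 i1 i2} => p q.
  by apply/eqP; rewrite eq_complex/=; apply/andP; split; apply/eqP; ring.
have b1 : normc (cint a b r1) <= 2 * ((M + M) * (b - a)).
  apply: cint_bound => // t tab; rewrite /r1.
  rewrite (_ : _ - K1 = (g t c - g x y - A * Complex (t - x) (c - y)) -
    (g t d - g x y - A * Complex (t - x) (d - y))).
    by rewrite (le_trans (normcB _ _))// lerD// H//; lra.
  have -> : K1 = A * Complex (t - x) (c - y) - A * Complex (t - x) (d - y).
    rewrite -mulrBr; congr (_ * _); apply/eqP; rewrite eq_complex/=.
    by apply/andP; split; apply/eqP; ring.
  by ring.
have b2 : normc (cint c d r2) <= 2 * ((M + M) * (d - c)).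
  apply: cint_bound => // t tcd; rewrite /r2.
  rewrite (_ : _ - K2 = (g b t - g x y - A * Complex (b - x) (t - y)) -
    (g a t - g x y - A * Complex (a - x) (t - y))).
    by rewrite (le_trans (normcB _ _))// lerD// H//; lra.
  have -> : K2 = A * Complex (b - x) (t - y) - A * Complex (a - x) (t - y).
    rewrite -mulrBr; congr (_ * _); apply/eqP; rewrite eq_complex/=.
    by apply/andP; split; apply/eqP; ring.
  by ring.
rewrite (le_trans (normcD _ _))// normcM normc_i normr1 mul1r.
by rewrite (le_trans (lerD b1 b2))// le_eqVlt; apply/orP; left; apply/eqP; ring.
Qed.

(** Halving each side in turn, and keeping the half with the larger integral each
    time, loses a factor 2 twice. *)
Lemma rint_quarter g x y w h : 0 <= w -> 0 <= h ->
  rintegrable g x (x + w) y (y + h) ->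
  exists x' y', [/\ x <= x', x' + w / 2 <= x + w, y <= y', y' + h / 2 <= y + h &
    normc (rint g x (x + w) y (y + h)) <=
    4 * normc (rint g x' (x' + w / 2) y' (y' + h / 2))].
Proof.
move=> w0 h0 ig.
have halfx : exists2 x', x <= x' /\ x' + w / 2 <= x + w &
    normc (rint g x (x + w) y (y + h)) <=
    2 * normc (rint g x' (x' + w / 2) y (y + h)).
  have -> : rint g x (x + w) y (y + h) =
      rint g x (x + w / 2) y (y + h) + rint g (x + w / 2) (x + w) y (y + h).
    by apply: rint_splitx => //; lra.
  have [H|/ltW H] := leP (normc (rint g (x + w / 2) (x + w) y (y + h)))
    (normc (rint g x (x + w / 2) y (y + h))).
    by exists x; [lra|rewrite (le_trans (normcD _ _))//; lra].
  exists (x + w / 2); first lra.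
  have -> : x + w / 2 + w / 2 = x + w by lra.
  by rewrite (le_trans (normcD _ _))//; lra.
have [x' [x1 x2] H1] := halfx.
have ig' : rintegrable g x' (x' + w / 2) y (y + h) by exact: rintegrableS ig.
have E : rint g x' (x' + w / 2) y (y + h) =
    rint g x' (x' + w / 2) y (y + h / 2) +
    rint g x' (x' + w / 2) (y + h / 2) (y + h).
  by apply: rint_splity => //; lra.
rewrite {}E in H1.
have := normcD (rint g x' (x' + w / 2) y (y + h / 2))
   (rint g x' (x' + w / 2) (y + h / 2) (y + h)) => H2.
have [H|/ltW H] := leP (normc (rint g x' (x' + w / 2) (y + h / 2) (y + h)))
    (normc (rint g x' (x' + w / 2) y (y + h / 2))).
  exists x', y; split=> //; first by clear -h0; lra.
  by clear -H H1 H2; lra.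
exists x', (y + h / 2); split=> //.
- by clear -h0; lra.
- by clear -h0; lra.
- have -> : y + h / 2 + h / 2 = y + h by field.
  by clear -H H1 H2; lra.
Qed.

(** Quartering repeatedly yields rectangles Q_k shrinking to a point, with
    |rint Q_0| <= 4^k |rint Q_k|.  At the limit point g is affine up to
    e * diameter, so that |rint Q_k| is at most a constant times e times the area
    of a square of side (b - a + d - c) / 2^k.  The powers of 4 cancel and e is
    arbitrary. *)
Theorem goursat g a b c d : a <= b -> c <= d ->
  (forall x y, a <= x <= b -> c <= y <= d -> cdiff2 g x y) ->
  rint g a b c d = 0.
Proof.
move=> ab cd dg.
have ig : rintegrable g a b c d.
  split=> [y ycd|x xab]; apply: ccontinuous_integrable => t t01.
    exact: (cdiff2_continuous (dg t y t01 ycd)).1.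
  exact: (cdiff2_continuous (dg x t xab t01)).2.
pose W k := (b - a) / 2 ^+ k; pose H k := (d - c) / 2 ^+ k.
have W0 k : 0 <= W k by rewrite divr_ge0 ?exprn_ge0// subr_ge0.
have H0 k : 0 <= H k by rewrite divr_ge0 ?exprn_ge0// subr_ge0.
have WS k : W k.+1 = W k / 2 by rewrite /W exprSr invfM mulrA.
have HS k : H k.+1 = H k / 2 by rewrite /H exprSr invfM mulrA.
pose ok k (p : R * R) := [/\ a <= p.1, p.1 + W k <= b, c <= p.2 & p.2 + H k <= d].
pose I k (p : R * R) := normc (rint g p.1 (p.1 + W k) p.2 (p.2 + H k)).
have /choice[f fP] : forall kp : nat * (R * R), exists p' : R * R,
    ok kp.1 kp.2 -> [/\ ok kp.1.+1 p', kp.2.1 <= p'.1,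
      p'.1 + W kp.1.+1 <= kp.2.1 + W kp.1, kp.2.2 <= p'.2 &
      p'.2 + H kp.1.+1 <= kp.2.2 + H kp.1 /\ I kp.1 kp.2 <= 4 * I kp.1.+1 p'].
  move=> [k p]; have [okp|] := pselect (ok k p); last by exists p.
  have [p1 p2 p3 p4] := okp.
  have [|x' [y' [q1 q2 q3 q4 q5]]] := @rint_quarter g p.1 p.2 (W k) (H k) (W0 k) (H0 k).
    exact: rintegrableS ig.
  exists (x', y') => _; rewrite /ok /I/= WS HS; do !split => //; lra.
pose P := fix P k := if k is j.+1 then f (j, P j) else (a, c).
have okP k : ok k (P k).
  elim: k => [|k IH]; last by have [] := fP (k, P k) IH.
  by split; rewrite /= ?lexx// /W /H expr0 divr1; lra.
have step k := fP (k, P k) (okP k); rewrite /= in step.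
have [xs xsP] : exists x, forall k, (P k).1 <= x <= (P k).1 + W k.
  apply: nested_segments => k; last by rewrite lerDl.
  - by have [] := step k.
  - by have [] := step k.
have [ys ysP] : exists x, forall k, (P k).2 <= x <= (P k).2 + H k.
  apply: nested_segments => k; last by rewrite lerDl.
  - by have [] := step k.
  - by have [_ _ _ _ []] := step k.
have II k : I 0%N (P 0%N) <= 4 ^+ k * I k (P k).
  elim: k => [|k IH]; first by rewrite mul1r.
  rewrite (le_trans IH)// exprSr -mulrA ler_pM2l ?exprn_gt0//.
  by have [_ _ _ _ []] := step k.
have <- : rint g (P 0%N).1 ((P 0%N).1 + W 0%N) (P 0%N).2 ((P 0%N).2 + H 0%N) = 
    rint g a b c d.
  by rewrite /= /W /H expr0 !divr1 !subrKC.
apply/eqP; rewrite -normc_le0 -/(I 0%N (P 0%N)).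
have [p1 p2 p3 p4] := okP 0%N.
have [A dA] : cdiff2 g xs ys.
  by apply: dg; [have := xsP 0%N|have := ysP 0%N]; lra.
set L := (b - a) + (d - c).
have L0 : 0 <= L by rewrite /L; lra.
apply/ler_addgt0Pr => e e0; rewrite add0r.
(* The bound obtained below is 4 L^2 times this quantity; the summand 1 avoids a
   division by 0 when the rectangle is a point. *)
have e'0 : 0 < e / (4 * (L ^+ 2 + 1)) by rewrite divr_gt0// mulr_gt0// ltr_wpDl ?sqr_ge0.
have [r r0 rP] := dA _ e'0.
have [k kr] := exists_halving_lt L r0.
have Wr : W k + H k < r by rewrite /W /H -mulrDl.
have [q1 q2 q3 q4] := okP k.
have := xsP k; have := ysP k => yk xk.
have := @rint_affine_bound g (P k).1 ((P k).1 + W k) (P k).2 ((P k).2 + H k) xs ys A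
  (e / (4 * (L ^+ 2 + 1)) * (W k + H k)) _ _ _ _.
rewrite !lerDl W0 H0 => /(_ isT isT) HB.
have {}HB : I k (P k) <= 4 * (e / (4 * (L ^+ 2 + 1)) * (W k + H k)) * (W k + H k).
  rewrite {2}(_ : W k + H k =
    (P k).1 + W k - (P k).1 + ((P k).2 + H k - (P k).2)); last by ring.
  apply: HB; first exact: rintegrableS ig.
  move=> x' y' x'k y'k.
  have ux : `|x' - xs| <= W k by rewrite ler_norml; lra.
  have uy : `|y' - ys| <= H k by rewrite ler_norml; lra.
  have := W0 k; have := H0 k => Hk Wk.
  rewrite (le_trans (rP x' y' _ _))//; try lra.
  by rewrite ler_pM2l// lerD.
rewrite (le_trans (II k))// (le_trans (ler_wpM2l _ HB)) ?exprn_ge0//.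
have -> : W k + H k = L / 2 ^+ k by rewrite /W /H -mulrDl.
have E : (4 : R) ^+ k = 2 ^+ k * 2 ^+ k by rewrite -exprMn -natrM.
have T0 : (2 : R) ^+ k != 0 by rewrite expf_neq0.
have L1 : L ^+ 2 + 1 != 0 by rewrite gt_eqF// ltr_wpDl ?sqr_ge0.
rewrite E; move: ((2 : R) ^+ k) T0 => T T0.
rewrite (_ : T * T * _ = L ^+ 2 / (L ^+ 2 + 1) * e); last by field; rewrite T0 L1.
rewrite ler_piMl ?(ltW e0)// ler_pdivrMr ?mul1r ?lerDl//.
by rewrite ltr_wpDl ?sqr_ge0.
Qed.

End goursat.

(** * Complex differentiability in terms of a real norm *)

Section differentiable_epsilon.
Context {R : realType}.

Lemma complex_gt0 (x : R[i]) : 0 < x -> x = (complex.Re x)%:C%C /\ 0 < complex.Re x.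
Proof. by case: x => a b; rewrite ltcE/= => /andP[/eqP -> ->]. Qed.

Lemma complex_ge0 (x : R[i]) : 0 <= x -> x = (complex.Re x)%:C%C /\ 0 <= complex.Re x.
Proof. by case: x => a b; rewrite lecE/= => /andP[/eqP -> ->]. Qed.

Lemma normC_normc (x : R[i]) : `|x| = (normc x)%:C%C.
Proof. by []. Qed.

Context {V : normedModType R[i]}.
Implicit Types (f : V -> R[i]) (z h : V).

(** The norm of a space over R[i] takes its values in R[i]; this is the same norm
    as a real number, so that real inequalities apply to it. *)
Definition rnorm h : R := complex.Re `|h|.

Lemma rnormE h : `|h| = (rnorm h)%:C%C.
Proof. by have [] := complex_ge0 (normr_ge0 h). Qed.

Lemma rnorm_ge0 h : 0 <= rnorm h.
Proof. by have [] := complex_ge0 (normr_ge0 h). Qed.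

Lemma rnormD h k : rnorm (h + k) <= rnorm h + rnorm k.
Proof. by rewrite -lecR rmorphD/= -!rnormE ler_normD. Qed.

Lemma rnormZ (c : R[i]) h : rnorm (c *: h) = normc c * rnorm h.
Proof.
have : (rnorm (c *: h))%:C%C = (normc c * rnorm h)%:C%C.
  by rewrite rmorphM/= -!rnormE -normC_normc normrZ.
by case.
Qed.

Lemma rnorm0 : rnorm 0 = 0.
Proof. by rewrite /rnorm normr0. Qed.

Lemma rnorm_eq0 h : rnorm h = 0 -> h = 0.
Proof. by move=> h0; apply/eqP; rewrite -normr_eq0 rnormE h0. Qed.

Lemma nbhs_rnormP z (A : set V) :
  nbhs z A <-> exists2 r : R, 0 < r & forall h, rnorm h < r -> A (z + h).
Proof.
split=> [/nbhs_normP[e /= /complex_gt0[-> e0] eA]|[r r0 rA]].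
  exists (complex.Re e) => // h hr; apply: eA.
  by rewrite /ball_/= opprD addNKr normrN rnormE ltcR.
apply/nbhs_normP; exists r%:C%C => /=; first by rewrite ltcR.
move=> t /=; rewrite distrC rnormE ltcR => /rA; by rewrite subrKC.
Qed.

Lemma differentiable_rnorm f z : differentiable f z ->
  forall e : R, 0 < e -> exists2 r : R, 0 < r & forall h, rnorm h < r ->
    normc (f (z + h) - f z - 'd f z h) <= e * rnorm h.
Proof.
move=> /diff_locallyP[_ /eqaddoP H] e e0.
have /H/nbhs_rnormP[r r0 rP] : 0 < e%:C%C :> R[i] by rewrite ltcR.
exists r => // h hr; have := rP _ hr; rewrite add0r rnormE normC_normc.
by rewrite -rmorphM lecR [z + h]addrC -[f _ - f z - _]addrA -opprD.
Qed.

(** With [differentiable_rnorm], translates differentiability into an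
    epsilon-delta condition on real norms, for any candidate L. *)
Lemma rnorm_differentiable f z (L : V -> R[i]) : linear L -> continuous L ->
  (forall e : R, 0 < e -> exists2 r : R, 0 < r & forall h, rnorm h < r ->
    normc (f (z + h) - f z - L h) <= e * rnorm h) ->
  differentiable f z /\ 'd f z = L :> (V -> R[i]).
Proof.
move=> linL cL H.
pose L' : {linear V -> R[i]} := HB.pack L (GRing.isLinear.Build _ _ _ _ _ linL).
have E : f \o shift z = cst (f z) + L' +o_ 0 id.
  apply/eqaddoP => e /complex_gt0[-> e0]; have [r r0 rP] := H _ e0.
  apply/nbhs_rnormP; exists r => // h hr; have := rP _ hr.
  rewrite add0r rnormE normC_normc -rmorphM lecR.
  by rewrite [z + h]addrC -[f _ - f z - _]addrA -opprD.
have dE := diff_unique (cL : continuous L') E.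
split; last exact: dE.
by apply/diff_locallyP; rewrite dE; split; [exact: cL|exact: E].
Qed.

End differentiable_epsilon.

(** * The complex exponential *)

Section real_derivative_epsilon.
Context {R : realType}.
Implicit Types (f : R -> R) (x df : R).

Lemma is_derive_eps f x df : is_derive x 1 f df ->
  forall e : R, 0 < e -> exists2 r : R, 0 < r &
    forall h, `|h| < r -> `|f (x + h) - f x - df * h| <= e * `|h|.
Proof.
move=> [dfx vfx] e e0; move/derivable1_diffP : (dfx) => /diff_locallyP[_].
rewrite deriv1E// derive1E vfx => /eqaddoP /(_ e e0) /nbhs_ballP[r r0 rP].
exists r => // h hr.
have := rP h; rewrite /ball/= sub0r normrN => /(_ hr).
by rewrite [x + h]addrC -[f _ - f x - _]addrA -opprD [df * h]mulrC.
Qed.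

Lemma eps_is_derive f x df : (forall e : R, 0 < e -> exists2 r : R, 0 < r &
    forall h, `|h| < r -> `|f (x + h) - f x - df * h| <= e * `|h|) ->
  is_derive x 1 f df.
Proof.
move=> H.
have C : h^-1 *: ((f \o shift x) (h *: 1) - f x) @[h --> 0^'] --> df.
  apply/cvgrPdist_le => /= e e0; have [r r0 rP] := H e e0.
  near=> h; have h0 : h != 0 by near: h; exact: nbhs_dnbhs_neq.
  have hr : `|h| < r by near: h; exact: dnbhs0_lt.
  have := rP h hr; rewrite /= [h *: 1]mulr1 [x + h]addrC.
  rewrite -ler_pdivrMr ?normr_gt0// -normfV -normrM distrC.
  by rewrite mulrBl mulfK// mulrC.
by apply: DeriveDef; [apply: cvgP C|exact: cvg_lim C].
Unshelve. all: by end_near. Qed.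

End real_derivative_epsilon.

Section complex_exponential.
Context {R : realType}.
Implicit Types (w z : R[i]) (x y : R).

Definition cexp w : R[i] := Complex
  (expR (complex.Re w) * cos (complex.Im w))
  (expR (complex.Re w) * sin (complex.Im w)).

Lemma cexpD w z : cexp (w + z) = cexp w * cexp z.
Proof.
case: w z => x y [x' y']; apply/eqP; rewrite eq_complex/= expRD cosD sinD.
by apply/andP; split; apply/eqP; ring.
Qed.

Lemma cexp0 : cexp 0 = 1.
Proof. by apply/eqP; rewrite eq_complex/= expR0 cos0 sin0 mul1r mulr0 !eqxx. Qed.

Lemma cexpN w : cexp (- w) * cexp w = 1.
Proof. by rewrite -cexpD addNr cexp0. Qed.

Lemma normc_cexp w : normc (cexp w) = expR (complex.Re w).
Proof.
rewrite /cexp /= !exprMn -mulrDr cos2Dsin2 mulr1 sqrtr_sqr.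
by rewrite gtr0_norm// expR_gt0.
Qed.

Lemma cexp_2pi x : cexp (Complex x (pi *+ 2)) = cexp (Complex x 0).
Proof. by rewrite /cexp /= cos2pi sin2pi cos0 sin0. Qed.

(** Differentiability of [cexp] at 0, from that of exp, cos and sin:
    e^h cos k - 1 - h = (e^h - 1 - h) cos k + h (cos k - 1) + (cos k - 1) and
    e^h sin k - k = (e^h - 1) sin k + (sin k - k). *)
Lemma cexp_eps (e : R) : 0 < e -> exists2 r : R, 0 < r &
  forall z, normc z < r -> normc (cexp z - 1 - z) <= e * normc z.
Proof.
move=> e0; pose e' := Num.min 1 (e / 6).
have e'0 : 0 < e' by rewrite lt_min ltr01 divr_gt0.
have e'1 : e' <= 1 by rewrite ge_min lexx.
have e'e : 6 * e' <= e by rewrite -ler_pdivlMl// mulrC ge_min lexx orbT.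
have [r1 r10 H1] := is_derive_eps (is_derive_expR (0 : R)) e'0.
have [r2 r20 H2] := is_derive_eps (is_derive_cos (0 : R)) e'0.
have [r3 r30 H3] := is_derive_eps (is_derive_sin (0 : R)) e'0.
exists (Num.min (Num.min r1 r2) (Num.min r3 (e' / 2))) => [|[h k]].
  by rewrite !lt_min r10 r20 r30 divr_gt0.
set N := normc _; rewrite !lt_min => /andP[/andP[z1 z2] /andP[z3 z4]].
have hN : `|h| <= N := abs_Re_le (Complex h k).
have kN : `|k| <= N := abs_Im_le (Complex h k).
have := H1 h (le_lt_trans hN z1); have := H2 k (le_lt_trans kN z2).
have := H3 k (le_lt_trans kN z3).
rewrite !add0r expR0 cos0 sin0 !mul1r subr0 oppr0 mul0r subr0 => K3 K2 K1.
have ck : `|cos k| <= 1 by rewrite ler_norml cos_geN1 cos_le1.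
have sk : `|sin k| <= 2 * N.
  rewrite -[sin k](subrK k) (le_trans (ler_normD _ _))//.
  have : e' * `|k| <= 1 * N by rewrite ler_pM// ltW.
  lra.
have eh : `|expR h - 1| <= e'.
  rewrite -[_ - 1](subrK h) (le_trans (ler_normD _ _))//.
  have : e' * `|h| <= 1 * N by rewrite ler_pM// ltW.
  lra.
have n0 : 0 <= N by exact: normc_ge0.
have b1 : `|expR h * cos k - 1 - h| <= 3 * e' * N.
  have -> : expR h * cos k - 1 - h =
    (expR h - 1 - h) * cos k + h * (cos k - 1) + (cos k - 1) by ring.
  rewrite (le_trans (ler_normD _ _))// (le_trans (lerD (ler_normD _ _) (lexx _)))//.
  rewrite !normrM.
  have A1 : `|expR h - 1 - h| * `|cos k| <= (e' * N) * 1.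
    by rewrite ler_pM// (le_trans K1)// ler_wpM2l// ltW.
  have A2 : `|cos k - 1| <= e' * N by rewrite (le_trans K2)// ler_wpM2l// ltW.
  have A3 : `|h| * `|cos k - 1| <= 1 * (e' * N) by rewrite ler_pM//; lra.
  lra.
have b2 : `|expR h * sin k - k| <= 3 * e' * N.
  have -> : expR h * sin k - k = (expR h - 1) * sin k + (sin k - k) by ring.
  rewrite (le_trans (ler_normD _ _))// normrM.
  have A1 : `|expR h - 1| * `|sin k| <= e' * (2 * N) by rewrite ler_pM.
  have A2 : `|sin k - k| <= e' * N by rewrite (le_trans K3)// ler_wpM2l// ltW.
  lra.
rewrite (le_trans (normc_le_ReIm _))//=.
rewrite (le_trans (lerD _ _) (_ : 3 * e' * N + 3 * e' * N <= _))//.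
  by rewrite oppr0 addr0.
by rewrite -mulrDl ler_wpM2r//; lra.
Qed.

(** The addition formula carries differentiability from 0 to w. *)
Lemma differentiable_cexp w : differentiable cexp w.
Proof.
pose L (h : R[i]) : R[i] := cexp w * h.
have linL : linear L by move=> a u v; rewrite /L mulrDr; congr (_ + _); exact: mulrCA.
apply: (rnorm_differentiable linL _ _).1.
  exact: mulrl_continuous.
move=> e e0; have c0 : 0 < normc (cexp w) by rewrite normc_cexp expR_gt0.
have [r r0 rP] := cexp_eps (divr_gt0 e0 c0).
exists r => // h hr.
have -> : cexp (w + h) - cexp w - L h = cexp w * (cexp h - 1 - h).
  by rewrite cexpD /L /=; ring.
by rewrite normcM -ler_pdivlMl// mulrA [_^-1 * e]mulrC; exact: rP.
Qed.

End complex_exponential.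

(** * Cauchy's formula for the derivative at the centre of a disc *)

Section cauchy.
Context {R : realType}.
Implicit Types (phi : R[i] -> R[i]) (w z : R[i]).

Lemma diff_scalar phi w z : 'd phi w z = z * 'd phi w 1.
Proof. by rewrite -{1}[z]mulr1; exact: (linearZZ ('d phi w) z 1). Qed.

Lemma differentiable_cdiff2 phi (x y : R) : differentiable phi (Complex x y) ->
  cdiff2 (fun x y => phi (Complex x y)) x y.
Proof.
move=> dphi; exists ('d phi (Complex x y) 1) => e e0.
have [r r0 rP] := differentiable_rnorm dphi e0.
exists (r / 2) => [|x' y' xr yr]; first by rewrite divr_gt0.
have hE : Complex x' y' = Complex x y + Complex (x' - x) (y' - y).
  by apply/eqP; rewrite eq_complex/= !subrKC !eqxx.
have hN : normc (Complex (x' - x) (y' - y)) <= `|x' - x| + `|y' - y|.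
  exact: (normc_le_ReIm (Complex (x' - x) (y' - y))).
have small : rnorm (Complex (x' - x) (y' - y)) < r.
  by apply: le_lt_trans hN _; lra.
have := rP _ small; rewrite -hE.
rewrite (diff_scalar _ _ (Complex (x' - x) _)) [Complex (x' - x) _ * _]mulrC => K.
by apply: le_trans K _; rewrite ler_pM2l.
Qed.

(** G(w) = phi(e^w) e^(-w) is 2 pi i-periodic, so that the horizontal sides of
    [x, ln r] x [0, 2 pi] cancel in Goursat's theorem and the integral over a
    vertical side does not depend on x.  For x close to -oo, G is close to phi'(0)
    since phi(0) = 0. *)
Lemma cauchy_derivative phi (rho r : R) :
  (forall z, normc z < rho -> differentiable phi z) -> phi 0 = 0 ->
  0 < r < rho ->
  cint 0 (pi *+ 2)
    (fun y => phi (cexp (Complex (ln r) y)) * cexp (- Complex (ln r) y)) =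
  (pi *+ 2)%:C%C * 'd phi 0 1.
Proof.
move=> dphi phi0 /andP[r0 rrho].
have p0 : 0 <= pi *+ 2 :> R by rewrite mulrn_wge0// pi_ge0.
pose G w := phi (cexp w) * cexp (- w).
pose g x y := G (Complex x y).
have dg x y : x <= ln r -> cdiff2 g x y.
  move=> xr; apply: differentiable_cdiff2.
  apply: differentiableM.
  - apply: differentiable_comp; first exact: differentiable_cexp.
    apply: dphi; rewrite normc_cexp /=.
    by rewrite (le_lt_trans _ rrho)// -[leRHS]lnK// ler_expR.
  - apply: (@differentiable_comp _ _ _ _ -%R cexp).
      by apply: differentiableN; exact: ex_diff.
    exact: differentiable_cexp.
have ig x : x <= ln r -> cintegrable 0 (pi *+ 2) (g x).
  move=> xr; apply: ccontinuous_integrable => y _.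
  exact: (cdiff2_continuous (dg x y xr)).2.
have Jcst x : x <= ln r -> cint 0 (pi *+ 2) (g (ln r)) = cint 0 (pi *+ 2) (g x).
  move=> xr; have dg' x' y : x <= x' <= ln r -> 0 <= y <= pi *+ 2 -> cdiff2 g x' y.
    by move=> /andP[_ x'r] _; exact: dg.
  have := goursat xr p0 dg'; rewrite /rint (@eq_cint _ _ _ _ (fun=> 0)); last first.
    move=> t _; rewrite /g /G cexp_2pi; apply/eqP; rewrite subr_eq0; apply/eqP.
    congr (_ * _).
    have -> : - Complex t (pi *+ 2) = Complex (- t) (- (pi *+ 2)) by [].
    have -> : - Complex t 0 = Complex (- t) 0 by rewrite -[in RHS]oppr0.
    by apply/eqP; rewrite eq_complex/= cosN sinN cos2pi sin2pi cos0 sin0 oppr0 !eqxx.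
  rewrite (cint_cst _ xr) mulr0 add0r => /eqP.
  rewrite mulf_eq0 [_ == 0](_ : _ = false) /=; last first.
    by rewrite eq_complex/= oner_eq0 andbF.
  move=> /eqP E.
  rewrite -[LHS](subrK (cint 0 (pi *+ 2) (g x))).
  rewrite -[RHS]add0r; congr (_ + _); rewrite -E.
  have := cintD (ig _ (lexx _)) (cintegrableZ (-1) (ig _ xr)).
  rewrite (cintZ (-1) (ig _ xr)) mulN1r => <-.
  by apply: eq_cint => t _; rewrite mulN1r.
rewrite -/(g _) -/(cint _ _ (g (ln r))).
set A := 'd phi 0 1.
apply/eqP; rewrite -subr_eq0 -normc_le0; apply/ler_addgt0Pr => e e0; rewrite add0r.
have pi2 : 0 < 2 * (pi *+ 2) :> R by rewrite mulr_gt0// mulrn_wgt0// pi_gt0.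
have e'0 : 0 < e / (2 * (pi *+ 2)) by rewrite divr_gt0.
have r0' : 0 < rho by exact: lt_trans rrho.
have [|d d0 dP] := differentiable_rnorm (dphi 0 _) e'0.
  by rewrite (normc0 R).
(* A vertical side whose image under cexp is a circle of radius less than d. *)
pose x := Num.min (ln r) (ln (d / 2)).
have xr : x <= ln r by rewrite ge_min lexx.
have xd : expR x < d.
  rewrite (@le_lt_trans _ _ (d / 2))//; last by rewrite ltr_pdivrMr// ltr_pMr// ltr1n.
  by rewrite -[leRHS]lnK ?posrE ?divr_gt0// ler_expR ge_min lexx orbT.
rewrite (Jcst _ xr).
have -> : (pi *+ 2)%:C%C * A = cint 0 (pi *+ 2) (fun=> A) by rewrite cint_cst// subr0.
have E : cint 0 (pi *+ 2) (g x) = cint 0 (pi *+ 2) (fun y => g x y - A) +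
    cint 0 (pi *+ 2) (fun=> A).
  rewrite -cintD; last 2 first.
  - by apply: cintegrableB; [exact: ig|exact: cintegrable_cst].
  - exact: cintegrable_cst.
  by apply: eq_cint => t _; rewrite subrK.
rewrite E addrK (le_trans (cint_bound (M := e / (2 * (pi *+ 2))) p0 _ _))//.
- by apply: cintegrableB; [exact: ig|exact: cintegrable_cst].
- move=> y _; set z := cexp (Complex x y).
  have zN : normc z = expR x by rewrite normc_cexp.
  have rN : rnorm z = expR x := zN.
  have := dP z; rewrite add0r phi0 subr0 rN => /(_ xd).
  have -> : 'd phi 0 z = z * A by exact: diff_scalar.
  have -> : g x y - A = cexp (- Complex x y) * (phi z - z * A).
    by rewrite mulrBr mulrA cexpN mul1r mulrC.
  rewrite normcM normc_cexp /= expRN => H.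
  by rewrite ler_pdivrMl ?expR_gt0// [expR x * _]mulrC.
- by rewrite subr0 mulrCA mulfVK// gt_eqF.
Qed.

End cauchy.

(** * Mean value inequalities along rays *)

Section segments.
Context {R : realType} {V : normedModType R[i]}.
Implicit Types (f : V -> R[i]) (z h : V) (p : R[i] -> R).

(** The mean value theorem fails for complex values, hence it is applied to
    p = Re and to p = Im. *)
Lemma part_ray_derive p f z h (t : R) :
  {morph p : x y / x - y} -> (forall (r : R) x, p (r%:C%C * x) = r * p x) ->
  (forall x, `|p x| <= normc x) ->
  differentiable f (z + t%:C%C *: h) ->
  is_derive t (1 : R) (fun t : R => p (f (z + t%:C%C *: h)))
    (p ('d f (z + t%:C%C *: h) h)).
Proof.
move=> pB pZ pN df; apply: eps_is_derive => e e0.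
have h0 : 0 < rnorm h + 1 by rewrite ltr_wpDl ?rnorm_ge0.
have [r r0 rP] := differentiable_rnorm df (divr_gt0 e0 h0).
exists (r / (rnorm h + 1)) => [|s]; first by rewrite divr_gt0.
rewrite ltr_pdivlMr// => sr.
have sE : rnorm (s%:C%C *: h) = `|s| * rnorm h by rewrite rnormZ normc_real.
have small : rnorm (s%:C%C *: h) < r.
  by rewrite sE (le_lt_trans _ sr)// ler_wpM2l// lerDl.
rewrite mulrC -pZ -!pB (le_trans (pN _))//.
have := rP _ small; rewrite linearZ/= -[z + _ + _]addrA -scalerDl -rmorphD/=.
move=> /le_trans -> //.
rewrite sE mulrAC ler_pdivrMr// -mulrA ler_wpM2l ?(ltW e0)//.
by rewrite ler_wpM2l// lerDl.
Qed.

Lemma part_ray_le p f z h (psi psi' : R -> R) (a b : R) :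
  {morph p : x y / x - y} -> (forall (r : R) x, p (r%:C%C * x) = r * p x) ->
  (forall x, `|p x| <= normc x) -> a <= b ->
  (forall t, a <= t <= b -> differentiable f (z + t%:C%C *: h)) ->
  (forall t, a <= t <= b -> is_derive t (1 : R) psi (psi' t)) ->
  (forall t, a <= t <= b -> normc ('d f (z + t%:C%C *: h) h) <= psi' t) ->
  `|p (f (z + b%:C%C *: h) - f (z + a%:C%C *: h))| <= psi b - psi a.
Proof.
move=> pB pZ pN ab df dpsi H.
pose u t := p (f (z + t%:C%C *: h)).
have du t : a <= t <= b -> is_derive t (1 : R) u (p ('d f (z + t%:C%C *: h) h)).
  by move=> tab; apply: part_ray_derive => //; exact: df.
have mono (v v' : R -> R) : (forall t, a <= t <= b -> is_derive t (1 : R) v (v' t)) ->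
    (forall t, a <= t <= b -> 0 <= v' t) -> v a <= v b.
  move=> dv v0.
  have cv : {within `[a, b], continuous v}.
    apply: derivable_within_continuous => t; rewrite in_itv/= => tab.
    exact: (@ex_derive _ _ _ _ _ _ _ (dv t tab)).
  have [|c cab E] := @MVT_segment R v v' a b ab _ cv.
    by move=> t /subset_itv_oo_cc; rewrite in_itv/=; exact: dv.
  rewrite -subr_ge0 E mulr_ge0// ?subr_ge0//; apply: v0.
  by rewrite in_itv/= in cab.
have bnd t : a <= t <= b -> `|p ('d f (z + t%:C%C *: h) h)| <= psi' t.
  by move=> tab; exact: le_trans (pN _) (H t tab).
have m1 : psi a - u a <= psi b - u b.
  apply: (mono (psi - u) (fun t => psi' t - p ('d f (z + t%:C%C *: h) h))) => t tab.
    by apply: is_deriveB; [exact: dpsi|exact: du].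
  by have := bnd t tab; rewrite ler_norml => /andP[_]; rewrite subr_ge0.
have m2 : psi a + u a <= psi b + u b.
  apply: (mono (psi + u) (fun t => psi' t + p ('d f (z + t%:C%C *: h) h))) => t tab.
    by apply: is_deriveD; [exact: dpsi|exact: du].
  by have := bnd t tab; rewrite ler_norml => /andP[+ _]; lra.
by rewrite pB -/(u b) -/(u a) ler_norml; lra.
Qed.

(** A primitive psi of a bound of the derivative bounds the increment; the factor 2
    accounts for the real and the imaginary part. *)
Lemma ray_mean_value f z h (psi psi' : R -> R) (a b : R) : a <= b ->
  (forall t, a <= t <= b -> differentiable f (z + t%:C%C *: h)) ->
  (forall t, a <= t <= b -> is_derive t (1 : R) psi (psi' t)) ->
  (forall t, a <= t <= b -> normc ('d f (z + t%:C%C *: h) h) <= psi' t) ->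
  normc (f (z + b%:C%C *: h) - f (z + a%:C%C *: h)) <= 2 * (psi b - psi a).
Proof.
move=> ab df dpsi H; rewrite (le_trans (normc_le_ReIm _))// mulr_natl mulr2n lerD//.
- apply: (part_ray_le (p := @complex.Re R)) H => //; first by move=> x y; rewrite raddfB.
    by move=> r [x y] /=; ring.
  exact: abs_Re_le.
- apply: (part_ray_le (p := @complex.Im R)) H => //; first by move=> x y; rewrite raddfB.
    by move=> r [x y] /=; ring.
  exact: abs_Im_le.
Qed.

Lemma segment_mean_value f z h (B : R) :
  (forall t, 0 <= t <= 1 -> differentiable f (z + t%:C%C *: h)) ->
  (forall t, 0 <= t <= 1 -> normc ('d f (z + t%:C%C *: h) h) <= B) ->
  normc (f (z + h) - f z) <= 2 * B.
Proof.
move=> df H; have := @ray_mean_value f z h (fun t => B * t) (fun=> B) 0 1 ler01 df _ H.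
rewrite scale0r addr0 scale1r mulr0 mulr1 subr0; apply=> t _.
have := is_deriveZ (f := id) B (is_derive_id t (1 : R)).
by rewrite [_ *: 1]mulr1.
Qed.

End segments.

(** * Cauchy's formula on complex lines of a normed space *)

Section circle_integral.
Context {R : realType}.
Implicit Types (F G : R[i] -> R[i]) (r : R).

Lemma for_continuous_ccontinuous (h : R -> R[i]) t :
  {for t, continuous h} -> ccontinuous h t.
Proof.
move=> /cvgrPdist_le ch e e0.
have /ch/nbhs_ballP[d d0 dP] : 0 < e%:C%C :> R[i] by rewrite ltcR.
exists d => // u ut; have := dP u; rewrite /ball/= distrC => /(_ ut).
by rewrite normC_normc lecR normc_distC.
Qed.

Lemma ccontinuous_for_continuous (h : R -> R[i]) t :
  ccontinuous h t -> {for t, continuous h}.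
Proof.
move=> ch; apply/cvgrPdist_le => e /complex_gt0[-> e0].
have [d d0 dP] := ch _ e0; apply/nbhs_ballP; exists d => // u.
by rewrite /ball/= distrC => /dP; rewrite normC_normc lecR normc_distC.
Qed.

Lemma cexp_vertical_continuous (x : R) : continuous (fun y => cexp (Complex x y)).
Proof.
move=> y; apply: ccontinuous_for_continuous.
exact: (cdiff2_continuous (differentiable_cdiff2 (differentiable_cexp _))).2.
Qed.

Definition circle_point r (y : R) := cexp (Complex (ln r) y).

Lemma normc_circle_point r y : 0 < r -> normc (circle_point r y) = r.
Proof. by move=> r0; rewrite normc_cexp /= lnK. Qed.

(** With z = r e^(iy), this is the contour integral of F(z) / (i z^2) along the
    circle of radius r, the right-hand side of Cauchy's formula for a
    derivative. *)
Definition circle_int r F := cint 0 (pi *+ 2)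
  (fun y => F (circle_point r y) * cexp (- Complex (ln r) y)).

Definition circle_continuous r F :=
  forall z, normc z = r -> {for z, continuous F}.

Lemma circle_integrable r F : 0 < r -> circle_continuous r F ->
  cintegrable 0 (pi *+ 2)
    (fun y => F (circle_point r y) * cexp (- Complex (ln r) y)).
Proof.
move=> r0 cF; apply: ccontinuous_integrable => y _.
apply: for_continuous_ccontinuous; apply: cvgM.
- apply: continuous_comp; first exact: cexp_vertical_continuous.
  by apply: cF; exact: normc_circle_point.
- apply: (@continuous_comp _ _ _ (fun y : R => - y) (fun y => cexp (Complex (- ln r) y))).
    exact: opp_continuous.
  exact: cexp_vertical_continuous.
Qed.

Lemma circle_intD r F G : 0 < r -> circle_continuous r F ->
  circle_continuous r G ->
  circle_int r (fun z => F z + G z) = circle_int r F + circle_int r G.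
Proof.
move=> r0 cF cG; rewrite -cintD; try exact: circle_integrable.
by apply: eq_cint => t _; rewrite mulrDl.
Qed.

Lemma circle_intZ r F k : 0 < r -> circle_continuous r F ->
  circle_int r (fun z => k * F z) = k * circle_int r F.
Proof.
move=> r0 cF; rewrite -cintZ; try exact: circle_integrable.
by apply: eq_cint => t _; rewrite mulrA.
Qed.

Lemma circle_continuousZ r F k : circle_continuous r F ->
  circle_continuous r (fun z => k * F z).
Proof. by move=> cF z zr; apply: continuousM; [exact: cst_continuous|exact: cF]. Qed.

Lemma circle_continuousB r F G : circle_continuous r F ->
  circle_continuous r G -> circle_continuous r (fun z => F z - G z).
Proof. by move=> cF cG z zr; apply: continuousB; [exact: cF|exact: cG]. Qed.

Lemma circle_intB r F G : 0 < r -> circle_continuous r F ->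
  circle_continuous r G ->
  circle_int r (fun z => F z - G z) = circle_int r F - circle_int r G.
Proof.
move=> r0 cF cG.
have -> : (fun z => F z - G z) = (fun z => F z + -1 * G z).
  by apply/funext => z; rewrite mulN1r.
rewrite (circle_intD r0 cF (circle_continuousZ (k := -1) cG)).
by rewrite (circle_intZ _ r0 cG) mulN1r.
Qed.

Lemma circle_int_bound r F B : 0 < r -> circle_continuous r F ->
  (forall z, normc z = r -> normc (F z) <= B) ->
  normc ((pi *+ 2)%:C%C^-1 * circle_int r F) <= 2 * B / r.
Proof.
move=> r0 cF FB.
have p0 : 0 < pi *+ 2 :> R by rewrite mulrn_wgt0// pi_gt0.
rewrite normcM normcV normc_real gtr0_norm// ler_pdivrMl//.
rewrite (_ : _ * (2 * B / r) = 2 * (B / r * (pi *+ 2 - 0))); last first.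
  by rewrite subr0; field; rewrite gt_eqF.
apply: cint_bound; [exact: ltW|exact: circle_integrable|move=> y _].
rewrite normcM normc_cexp /= expRN lnK// ler_wpM2r ?invr_ge0 ?(ltW r0)//.
by apply: FB; exact: normc_circle_point.
Qed.

End circle_integral.

Section cauchy_several.
Context {R : realType} {V : normedModType R[i]}.
Implicit Types (f : V -> R[i]) (z h v : V).

Lemma locally_lipschitz_continuous f z (r K : R) : 0 < r ->
  (forall h, rnorm h < r -> normc (f (z + h) - f z) <= K * rnorm h) ->
  {for z, continuous f}.
Proof.
move=> r0 fK; apply/cvgrPdist_le => e /complex_gt0[-> e0].
have K0 : 0 < `|K| + 1 by rewrite ltr_wpDl.
apply/nbhs_rnormP; exists (Num.min r (complex.Re e / (`|K| + 1))) => [|h].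
  by rewrite lt_min r0 divr_gt0.
rewrite lt_min => /andP[hr he].
rewrite normC_normc lecR normc_distC (le_trans (fK _ hr))//.
rewrite (@le_trans _ _ ((`|K| + 1) * rnorm h))//.
  by rewrite ler_wpM2r ?rnorm_ge0// ler_wpDr// ler_norm.
by rewrite mulrC -ler_pdivlMr// ltW.
Qed.

Lemma linear_rnorm_continuous (L : V -> R[i]) (B : R) : linear L ->
  (forall h, normc (L h) <= B * rnorm h) -> continuous L.
Proof.
move=> linL LB z; apply: (@locally_lipschitz_continuous _ _ 1 B) => // h _.
suff -> : L (z + h) - L z = L h by exact: LB.
by have := linL 1 h z; rewrite !scale1r [h + z]addrC => ->; rewrite addrK.
Qed.

Lemma diff_eq0 f z : 'd f z 0 = 0. Proof. exact: linear0. Qed.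

Lemma differentiable_line f z v (t : R[i]) : differentiable f (z + t *: v) ->
  differentiable (fun t : R[i] => f (z + t *: v)) t.
Proof.
move=> df.
apply: (@differentiable_comp _ _ _ _ (fun t : R[i] => z + t *: v) f) => //.
Qed.

Lemma diff_line f z v : differentiable f z ->
  'd (fun t : R[i] => f (z + t *: v) - f z) 0 1 = 'd f z v.
Proof.
move=> df; have dl : differentiable (fun t : R[i] => f (z + t *: v)) 0.
  by apply: differentiable_line; rewrite scale0r addr0.
have dlB : differentiable (fun t : R[i] => f (z + t *: v) - f z) 0.
  exact: differentiableB.
rewrite -(deriveE (1 : R[i]) dlB) -(deriveE v df).
rewrite /derive; set q := (X in _ = lim (X @ _)).
set q' := (X in lim (X @ _) = _); suff -> : q' = q by [].
rewrite /q /q'; apply/funext => t /=.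
by rewrite scale0r !addr0 subrr subr0 [t%:A]mulr1 [t *: v + z]addrC.
Qed.

Lemma circle_continuous_line f z v (rho r : R) :
  (forall h, rnorm h < rho -> differentiable f (z + h)) ->
  r * rnorm v < rho ->
  circle_continuous r (fun t : R[i] => f (z + t *: v) - f z).
Proof.
move=> df rv t tr; apply: continuousB; last exact: cst_continuous.
apply: differentiable_continuous; apply: differentiable_line.
by apply: df; rewrite rnormZ tr.
Qed.

(** [cauchy_derivative] for t |-> f(z + tv) - f(z), whose derivative at 0 is the
    differential of f at z in the direction v. *)
Lemma cauchy_diff f z v (rho r : R) :
  (forall h, rnorm h < rho -> differentiable f (z + h)) ->
  0 < r -> r * rnorm v < rho ->
  'd f z v = (pi *+ 2)%:C%C^-1 * circle_int r (fun t : R[i] => f (z + t *: v) - f z).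
Proof.
move=> df r0 rv.
have rho0 : 0 < rho by rewrite (le_lt_trans _ rv)// mulr_ge0 ?rnorm_ge0 ?ltW.
have p0 : 0 < pi *+ 2 :> R by rewrite mulrn_wgt0// pi_gt0.
have pC : (pi *+ 2)%:C%C != 0 :> R[i] by rewrite eq_complex/= gt_eqF.
have dfz : differentiable f z.
  by have := df 0; rewrite addr0; apply; rewrite rnorm0.
have [rho' rr' H] : exists2 rho', r < rho' &
    forall t : R[i], normc t < rho' -> rnorm (t *: v) < rho.
  have [v0|v0] := eqVneq (rnorm v) 0.
    by exists (r + 1) => [|t _]; rewrite ?ltrDl// rnormZ v0 mulr0.
  have {}v0 : 0 < rnorm v by rewrite lt_neqAle eq_sym v0 rnorm_ge0.
  exists (rho / rnorm v) => [|t]; first by rewrite ltr_pdivlMr.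
  by rewrite ltr_pdivlMr// rnormZ.
rewrite -(diff_line v dfz); apply: (mulfI pC); rewrite mulVKf//.
apply: esym; apply: (@cauchy_derivative _ _ rho' r).
- move=> t tr; apply: differentiableB; last exact: differentiable_cst.
  by apply: differentiable_line; apply: df; exact: H.
- by rewrite scale0r addr0 subrr.
- by rewrite r0.
Qed.

End cauchy_several.

(** * The differential of a holomorphic function is holomorphic *)

Lemma half_lt {R : realType} (x : R) : 0 < x -> x / 2 < x.
Proof. by move=> x0; rewrite ltr_pdivrMr// ltr_pMr// ltr1n. Qed.

(** The data of this section: f is differentiable and bounded by M on the ball of
    radius 4 rho around c.  Each use of Cauchy's formula costs a ball of radius
    rho, since it takes values of f on circles of radius rho / 2 around the
    point. *)
Section regularity.
Context {R : realType} {V : normedModType R[i]}.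
Context (f : V -> R[i]) (c : V) (rho M : R) (rho0 : 0 < rho)
  (df : forall h, rnorm h < 4 * rho -> differentiable f (c + h))
  (fM : forall h, rnorm h < 4 * rho -> normc (f (c + h)) <= M).
Implicit Types (h k v : V).

Let df3 h k : rnorm h < 3 * rho -> rnorm k < rho -> differentiable f (c + h + k).
Proof.
have rho_gt0 := rho0.
move=> h3 k1; rewrite -addrA; apply: df.
by rewrite (le_lt_trans (rnormD _ _))//; lra.
Qed.

(** Cauchy's formula on the circle of radius r = rho / (2 |v|) in the complex line
    directed by v, whose points are at distance rho / 2 from c + h. *)
Lemma cauchy_estimate h v : rnorm h < 3 * rho ->
  normc ('d f (c + h) v) <= 8 * M / rho * rnorm v.
Proof.
have rho_gt0 := rho0.
move=> h3; have [v0|v0] := eqVneq (rnorm v) 0.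
  by rewrite (rnorm_eq0 v0) diff_eq0 (normc0 R) rnorm0 mulr0.
have {}v0 : 0 < rnorm v by rewrite lt_neqAle eq_sym v0 rnorm_ge0.
pose r := rho / (2 * rnorm v).
have r0 : 0 < r by rewrite divr_gt0// mulr_gt0.
have rv : r * rnorm v = rho / 2 by rewrite /r; field; rewrite gt_eqF.
have rv1 : r * rnorm v < rho by rewrite rv half_lt.
have dfh := df3 h3.
rewrite (cauchy_diff dfh r0 rv1).
rewrite (le_trans (circle_int_bound (B := M + M) r0 (circle_continuous_line dfh rv1) _))//.
  move=> z zr; rewrite (le_trans (normcB _ _))// lerD//; last by apply: fM; lra.
  rewrite -addrA; apply: fM; rewrite (le_lt_trans (rnormD _ _))// rnormZ zr rv.
  lra.
rewrite le_eqVlt; apply/orP; left; apply/eqP; rewrite /r.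
by field; rewrite !gt_eqF.
Qed.

Let K1 := 8 * M / rho.

Let M0 : 0 <= M.
Proof.
by apply: le_trans (fM (h := 0) _); rewrite ?normc_ge0 ?rnorm0 ?mulr_gt0.
Qed.

Let K10 : 0 <= K1.
Proof. by rewrite /K1 divr_ge0 ?mulr_ge0// ltW. Qed.

Lemma rnorm_segment h k (r t : R) : rnorm h < r -> rnorm (h + k) < r ->
  0 <= t <= 1 -> rnorm (h + t%:C%C *: k) < r.
Proof.
move=> hr hkr /andP[t0 t1].
have -> : h + t%:C%C *: k = (1 - t)%:C%C *: h + t%:C%C *: (h + k).
  rewrite scalerDr addrA -scalerDl -rmorphD/= subrK.
  by rewrite (_ : 1%:C%C = 1)// scale1r.
rewrite (le_lt_trans (rnormD _ _))// !rnormZ !normc_real.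
rewrite (ger0_norm t0) ger0_norm ?subr_ge0//.
pose m := Num.max (rnorm h) (rnorm (h + k)).
have mr : m < r by rewrite gt_max hr.
rewrite (le_lt_trans _ mr)// (@le_trans _ _ ((1 - t) * m + t * m))//.
  by rewrite lerD// ler_wpM2l ?subr_ge0// le_max lexx ?orbT.
by rewrite -mulrDl subrK mul1r.
Qed.

Let df3' h : rnorm h < 3 * rho -> differentiable f (c + h).
Proof.
have rho_gt0 := rho0.
by move=> h3; apply: df; lra.
Qed.

Lemma holomorphic_lipschitz h k : rnorm h < 3 * rho -> rnorm (h + k) < 3 * rho ->
  normc (f (c + h + k) - f (c + h)) <= 2 * (K1 * rnorm k).
Proof.
move=> h3 hk3; apply: segment_mean_value => t t01; rewrite -addrA.
  by apply: df3'; exact: rnorm_segment.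
by apply: cauchy_estimate; exact: rnorm_segment.
Qed.

Let K2 := 16 * K1 / rho.

Let K20 : 0 <= K2.
Proof. by apply: divr_ge0; [exact: mulr_ge0|exact: ltW]. Qed.

(** Difference of two instances of Cauchy's formula.  The integrand is a difference
    of two increments of f, each of them controlled by
    [holomorphic_lipschitz]. *)
Lemma diff_lipschitz h k v : rnorm h < 2 * rho -> rnorm (h + k) < 2 * rho ->
  normc ('d f (c + (h + k)) v - 'd f (c + h) v) <= K2 * rnorm v * rnorm k.
Proof.
have rho_gt0 := rho0.
move=> h2 hk2; have [v0|v0] := eqVneq (rnorm v) 0.
  by rewrite (rnorm_eq0 v0) !diff_eq0 subrr (normc0 R) rnorm0 mulr0 mul0r.
have {}v0 : 0 < rnorm v by rewrite lt_neqAle eq_sym v0 rnorm_ge0.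
pose r := rho / (2 * rnorm v).
have r0 : 0 < r by rewrite divr_gt0// mulr_gt0.
have rv : r * rnorm v = rho / 2 by rewrite /r; field; rewrite gt_eqF.
have rv1 : r * rnorm v < rho by rewrite rv half_lt.
have dfh k' : rnorm k' < rho -> differentiable f (c + h + k').
  by move=> k'1; apply: df3 => //; lra.
have dfhk k' : rnorm k' < rho -> differentiable f (c + (h + k) + k').
  by move=> k'1; apply: df3 => //; lra.
have c1 := circle_continuous_line dfh rv1.
have c2 := circle_continuous_line dfhk rv1.
rewrite (cauchy_diff dfh r0 rv1) (cauchy_diff dfhk r0 rv1) -mulrBr.
rewrite -(circle_intB r0 c2 c1).
rewrite (le_trans (circle_int_bound
  (B := 2 * (K1 * rnorm k) + 2 * (K1 * rnorm k)) r0 (circle_continuousB c2 c1) _))//.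
  move=> z zr.
  have zv : rnorm (z *: v) = rho / 2 by rewrite rnormZ zr.
  have -> : f (c + (h + k) + z *: v) - f (c + (h + k)) -
      (f (c + h + z *: v) - f (c + h)) =
      (f (c + (h + z *: v) + k) - f (c + (h + z *: v))) - (f (c + h + k) - f (c + h)).
    rewrite -!addrA [k + _]addrC; ring.
  rewrite (le_trans (normcB _ _))// lerD// holomorphic_lipschitz//; try lra.
  - by rewrite (le_lt_trans (rnormD _ _))//; lra.
  - by rewrite addrAC (le_lt_trans (rnormD _ _))//; lra.
rewrite le_eqVlt; apply/orP; left; apply/eqP; rewrite /K2 /r.
by field; rewrite !gt_eqF.
Qed.

(** Mean value inequality for F = f - 'd f (c + h), whose differential at
    c + h + tk is small by [diff_lipschitz]. *)
Lemma taylor_first h k : rnorm h < 2 * rho -> rnorm (h + k) < 2 * rho ->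
  normc (f (c + h + k) - f (c + h) - 'd f (c + h) k) <=
  2 * (K2 * rnorm k * rnorm k).
Proof.
have rho_gt0 := rho0.
move=> h2 hk2.
have dh : differentiable f (c + h) by apply: df3'; lra.
pose L := 'd f (c + h); have cL : continuous L by exact: diff_continuous.
pose F := f - (L : V -> R[i]).
have dL w : differentiable (L : V -> R[i]) w by exact: linear_differentiable.
have -> : f (c + h + k) - f (c + h) - 'd f (c + h) k = F (c + h + k) - F (c + h).
  rewrite /F !fctE -/L.
  have -> : L (c + h + k) = L (c + h) + L k by rewrite linearD.
  ring.
have seg t : 0 <= t <= 1 -> rnorm (h + t%:C%C *: k) < 2 * rho.
  exact: rnorm_segment.
apply: segment_mean_value => t t01; rewrite -addrA.
  by apply: differentiableB (dL _); apply: df3'; have := seg t t01; lra.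
have dt : differentiable f (c + (h + t%:C%C *: k)).
  by apply: df3'; have := seg t t01; lra.
pose w := c + (h + t%:C%C *: k).
have dLw : 'd (L : V -> R[i]) w k = L k by exact: (congr1 (@^~ k) (diff_lin w cL)).
have -> : 'd F w k = 'd f w k - L k.
  by rewrite -dLw; exact: (congr1 (@^~ k) (diffB dt (dL w))).
rewrite (le_trans (diff_lipschitz _ _ _))//; first exact: seg.
rewrite rnormZ normc_real; apply: ler_wpM2l.
  by apply: mulr_ge0 => //; exact: rnorm_ge0.
by move: t01 => /andP[t0 t1]; rewrite ger0_norm// ler_piMl ?rnorm_ge0.
Qed.

(** Differentiation under the integral sign in Cauchy's formula.  The candidate
    for the derivative of z |-> 'd f z v in the direction k is the integral L k of
    the differentials in the direction k at the points of the circle, minus their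
    value at c; the error is an integral of Taylor remainders, which
    [taylor_first] bounds by a multiple of |k|^2. *)
Theorem diff_differentiable v : differentiable (fun z => 'd f z v) c.
Proof.
have rho_gt0 := rho0.
have [v0|v0] := eqVneq (rnorm v) 0.
  rewrite (rnorm_eq0 v0) (_ : (fun z => _) = cst 0); first exact: differentiable_cst.
  by apply/funext => z; rewrite diff_eq0.
have {}v0 : 0 < rnorm v by rewrite lt_neqAle eq_sym v0 rnorm_ge0.
pose r := rho / (2 * rnorm v).
have r0 : 0 < r by rewrite divr_gt0// mulr_gt0.
have rv : r * rnorm v = rho / 2 by rewrite /r; field; rewrite gt_eqF.
have rv1 : r * rnorm v < rho by rewrite rv half_lt.
(* The value at c is subtracted to match the integrand of cauchy_diff; its
   contribution to the integral is 0. *)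
pose F k (t : R[i]) := 'd f (c + t *: v) k - 'd f c k.
have tv t : normc t = r -> rnorm (t *: v) = rho / 2 by move=> tr; rewrite rnormZ tr.
have cF k : circle_continuous r (F k).
  move=> t tr; apply: continuousB; last exact: cst_continuous.
  apply: (@locally_lipschitz_continuous _ _ _ _ (r / 2) (K2 * rnorm k * rnorm v)).
    by rewrite divr_gt0.
  move=> s sr.
  have sv : rnorm (s *: v) < rho / 2.
    rewrite rnormZ -rv ltr_pM2r// (lt_trans sr)//; exact: half_lt.
  have tsv : rnorm (t *: v + s *: v) < 2 * rho.
    by rewrite (le_lt_trans (rnormD _ _))// tv//; lra.
  rewrite scalerDl (le_trans (diff_lipschitz _ _ tsv))//; first by rewrite tv//; lra.
  by rewrite rnormZ mulrCA mulrC.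
pose L k := (pi *+ 2)%:C%C^-1 * circle_int r (F k).
have linL : linear L.
  move=> a k k'; rewrite /L.
  have -> : F (a *: k + k') = (fun t => a * F k t + F k' t).
    have dP w : 'd f w (a *: k + k') = a * 'd f w k + 'd f w k' by exact: linearP.
    by apply/funext => t; rewrite /F !dP; ring.
  rewrite (circle_intD r0 (circle_continuousZ (k := a) (cF k)) (cF k')).
  rewrite (circle_intZ _ r0 (cF k)).
  by rewrite mulrDr; congr (_ + _); exact: mulrCA.
have z2 : rnorm (0 : V) < 2 * rho by rewrite rnorm0 mulr_gt0.
have z3 : rnorm (0 : V) < 3 * rho by rewrite rnorm0 mulr_gt0.
have LB k : normc (L k) <= 2 * (2 * K1) / r * rnorm k.
  rewrite (le_trans (circle_int_bound (B := 2 * K1 * rnorm k) r0 (cF k) _))//.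
    move=> t tr; rewrite (le_trans (normcB _ _))// mulr_natl mulr2n mulrDl lerD//.
    - by apply: cauchy_estimate; rewrite tv//; lra.
    - by rewrite -[c]addr0; exact: cauchy_estimate.
  by rewrite le_eqVlt; apply/orP; left; apply/eqP; field; rewrite gt_eqF.
have cL := linear_rnorm_continuous linL LB.
apply: (@rnorm_differentiable _ _ (fun z => 'd f z v) c L linL cL _).1.
move=> e e0.
pose C := 8 * K2 / r.
have C0 : 0 < C + 1.
  by apply: ltr_wpDl => //; apply: divr_ge0 (ltW r0); exact: mulr_ge0.
exists (Num.min rho (e / (C + 1))) => [|h]; first by rewrite lt_min rho0 divr_gt0.
rewrite lt_min => /andP[h1 he].
have df0 k' : rnorm k' < rho -> differentiable f (c + k').
  by move=> ?; apply: df; lra.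
have dfh k' : rnorm k' < rho -> differentiable f (c + h + k').
  by move=> ?; apply: df3 => //; lra.
have c1 := circle_continuous_line df0 rv1.
have c2 := circle_continuous_line dfh rv1.
rewrite (cauchy_diff df0 r0 rv1) (cauchy_diff dfh r0 rv1) -!mulrBr.
rewrite -(circle_intB r0 c2 c1) -(circle_intB r0 (circle_continuousB c2 c1) (cF h)).
rewrite (le_trans (circle_int_bound
  (B := 2 * (K2 * rnorm h * rnorm h) + 2 * (K2 * rnorm h * rnorm h)) r0
  (circle_continuousB (circle_continuousB c2 c1) (cF h)) _))//.
  move=> t tr; rewrite /F.
  have -> : f (c + h + t *: v) - f (c + h) - (f (c + t *: v) - f c) -
      ('d f (c + t *: v) h - 'd f c h) =
      (f (c + t *: v + h) - f (c + t *: v) - 'd f (c + t *: v) h) -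
      (f (c + 0 + h) - f (c + 0) - 'd f (c + 0) h).
    by rewrite addr0 [c + h + _]addrAC; ring.
  rewrite (le_trans (normcB _ _))// lerD// taylor_first//.
  - by rewrite tv//; lra.
  - by rewrite (le_lt_trans (rnormD _ _))// tv//; lra.
  - by rewrite add0r; lra.
have -> : 2 * (2 * (K2 * rnorm h * rnorm h) + 2 * (K2 * rnorm h * rnorm h)) / r =
    C * rnorm h * rnorm h by rewrite /C; field; rewrite gt_eqF.
rewrite ler_wpM2r ?rnorm_ge0// (@le_trans _ _ ((C + 1) * rnorm h))//.
  by rewrite ler_wpM2r ?rnorm_ge0// lerDl.
by rewrite mulrC -ler_pdivlMr// ltW.
Qed.

End regularity.

(** * The unit ball and the radial derivative *)

Section ball_geometry.
Context {R : realType} {n : nat}.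
Implicit Types (c h z : 'rV[R[i]]_n) (f : 'rV[R[i]]_n -> R[i]).

Lemma sqnorm_ge0 z : 0 <= sqnorm z.
Proof. by apply: sumr_ge0 => k _; exact: sqr_ge0. Qed.

Lemma sqnormZ (t : R) z : sqnorm (t%:C%C *: z) = t ^+ 2 * sqnorm z.
Proof.
rewrite /sqnorm mulr_sumr; apply: eq_bigr => k _.
by rewrite mxE normcM normc_real exprMn real_normK ?num_real.
Qed.

Lemma unit_ball0 : unit_ball (0 : 'rV[R[i]]_n).
Proof.
rewrite /unit_ball/= /sqnorm big1 ?ltr01// => k _.
by rewrite mxE (normc0 R) expr0n.
Qed.

Lemma normc_coord_le_sqnorm z k : normc (z 0 k) ^+ 2 <= sqnorm z.
Proof.
rewrite /sqnorm (bigD1 k)//= lerDl sumr_ge0// => j _; exact: sqr_ge0.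
Qed.

Lemma normc_coord_le_rnorm h k : normc (h 0 k) <= rnorm h.
Proof.
have H : `|h 0 k| <= mx_norm h.
  rewrite mx_normE -[leLHS]nngE num_le.
  exact: (le_bigmax _ (fun i : 'I_1 * 'I_n => `|h i.1 i.2|%:nng) (0, k)).
by rewrite -lecR -rnormE.
Qed.

Lemma rnorm_le_sqrt_sqnorm h : rnorm h <= Num.sqrt (sqnorm h).
Proof.
have [h0|h0] := eqVneq (mx_norm h) 0.
  by rewrite (_ : h = 0) ?rnorm0 ?sqrtr_ge0//; exact: mx_norm_eq0.
have [[i k] /= hik] := mx_norm_neq0 h0.
have -> : rnorm h = normc (h 0 k) by rewrite /rnorm [`|h|]hik (ord1 i).
rewrite -[leLHS]ger0_norm ?normc_ge0// -sqrtr_sqr ler_wsqrtr//.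
exact: normc_coord_le_sqnorm.
Qed.

(** If |h| <= 1 then |c_k + h_k|^2 <= |c_k|^2 + 3 |h|, as |c_k| <= 1. *)
Lemma unit_ball_open c : unit_ball c -> exists2 r : R, 0 < r &
  forall h, rnorm h < r -> unit_ball (c + h).
Proof.
rewrite /unit_ball/= => c1; pose K : R := (3 * n)%:R + 1.
have K0 : 0 < K by rewrite ltr_wpDl.
exists (Num.min 1 ((1 - sqnorm c) / K)) => [|h].
  by rewrite lt_min ltr01 divr_gt0// subr_gt0.
rewrite lt_min => /andP[h1 hc].
apply: (@le_lt_trans _ _ (sqnorm c + K * rnorm h)); last first.
  by rewrite -ltrBrDl mulrC -ltr_pdivlMr.
apply: (@le_trans _ _ (\sum_(k < n) (normc (c 0 k) ^+ 2 + 3 * rnorm h))).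
  apply: ler_sum => k _; rewrite mxE.
  have ck : normc (c 0 k) <= 1.
    rewrite -(@expr_le1 _ 2) ?normc_ge0// (le_trans (normc_coord_le_sqnorm _ _))//.
    exact: ltW.
  apply: (@le_trans _ _ ((normc (c 0 k) + rnorm h) ^+ 2)).
    rewrite ler_sqr ?nnegrE ?addr_ge0 ?normc_ge0 ?rnorm_ge0//.
    by rewrite (le_trans (normcD _ _))// lerD2l normc_coord_le_rnorm.
  have := rnorm_ge0 h; have := normc_ge0 (c 0 k).
  move: (normc (c 0 k)) (rnorm h) ck h1 => a b a1 b1 a0 b0.
  nra.
rewrite big_split/= lerD2l sumr_const card_ord -[leLHS]mulr_natr mulrAC -natrM.
by rewrite ler_wpM2r ?rnorm_ge0// lerDl.
Qed.

(** Provides the data of the regularity theorem around a point of the unit ball;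
    the bound M comes from continuity at c. *)
Lemma holomorphic_near c f : unit_ball c -> holomorphic f ->
  exists rho M : R, [/\ 0 < rho,
    forall h, rnorm h < 4 * rho -> unit_ball (c + h),
    forall h, rnorm h < 4 * rho -> differentiable f (c + h) &
    forall h, rnorm h < 4 * rho -> normc (f (c + h)) <= M].
Proof.
move=> c1 hf; have [r r0 rP] := unit_ball_open c1.
have /differentiable_continuous/cvgrPdist_le/(_ 1 ltr01) := hf _ c1.
move=> /nbhs_rnormP[d d0 dP].
exists (Num.min r d / 4), (normc (f c) + 1).
have E : 4 * (Num.min r d / 4) = Num.min r d by field.
split; rewrite ?E.
- by rewrite divr_gt0// lt_min r0.
- by move=> h; rewrite lt_min => /andP[/rP].
- by move=> h; rewrite lt_min => /andP[/rP/hf].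
- move=> h; rewrite lt_min => /andP[_ /dP].
  rewrite normC_normc (_ : 1 = 1%:C%C)// lecR normc_distC => H.
  by rewrite -[f (c + h)](subrK (f c)) (le_trans (normcD _ _))// addrC lerD2l.
Qed.

Lemma diff_coord f z v : 'd f z v = \sum_(k < n) v 0 k * 'd f z ('e_k).
Proof.
rewrite {1}(row_sum_delta v) linear_sum; apply: eq_bigr => k _.
exact: linearZ.
Qed.

(** R is differentiation in the direction of the point itself. *)
Lemma Rderiv_diff f z : differentiable f z -> Rderiv f z = 'd f z z.
Proof.
move=> df; rewrite (diff_coord f z z); apply: eq_bigr => k _.
by rewrite -(deriveE 'e_k df).
Qed.

(** R f is expressed by the differential only where f is differentiable, that is,
    inside the ball; differentiability being local, this is enough. *)
Lemma near_differentiable f g z (r : R) : 0 < r ->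
  (forall h, rnorm h < r -> f (z + h) = g (z + h)) ->
  differentiable f z -> differentiable g z.
Proof.
move=> r0 fg df.
have linL : linear ('d f z) by move=> a u v; exact: linearP.
apply: (@rnorm_differentiable _ _ g z ('d f z) linL (diff_continuous df) _).1.
move=> e e0; have [d d0 dP] := differentiable_rnorm df e0.
exists (Num.min r d) => [|h]; first by rewrite lt_min r0.
rewrite lt_min => /andP[hr hd]; rewrite -fg//.
have := fg 0; rewrite addr0 rnorm0 => /(_ r0) <-; exact: dP.
Qed.

Lemma Rderiv_holomorphic f : holomorphic f -> holomorphic (Rderiv f).
Proof.
move=> hf c c1.
have [rho [M [rho0 cB df fM]]] := holomorphic_near c1 hf.
have dfc : differentiable f c by exact: hf.
apply: (@near_differentiable
  (\sum_(k < n) (fun z => z 0 k * 'd f z ('e_k))) _ _ (4 * rho)).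
- by rewrite mulr_gt0.
- move=> h hr.
  apply: etrans (esym (etrans (Rderiv_diff (df _ hr)) (diff_coord f _ (c + h)))).
  by rewrite fct_sumE.
- apply: differentiable_sum => k; apply: differentiableM.
    exact: differentiable_coord.
  exact: diff_differentiable rho0 df fM _.
Qed.

Lemma iter_Rderiv_holomorphic f k : holomorphic f -> holomorphic (iter k Rderiv f).
Proof. by move=> hf; elim: k => // k IH; exact: Rderiv_holomorphic. Qed.

End ball_geometry.

(** * Integrating a radial growth condition *)

Section radial_growth.
Context {R : realType} {n : nat}.
Implicit Types (z : 'rV[R[i]]_n) (f : 'rV[R[i]]_n -> R[i]).

Definition enorm z : R := Num.sqrt (sqnorm z).

Lemma enorm_ge0 z : 0 <= enorm z. Proof. exact: sqrtr_ge0. Qed.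

Lemma sqr_enorm z : enorm z ^+ 2 = sqnorm z.
Proof. by rewrite sqr_sqrtr// sqnorm_ge0. Qed.

Lemma enorm_lt1 z : unit_ball z -> enorm z < 1.
Proof.
by rewrite /unit_ball/= -sqr_enorm => z1; rewrite -(@expr_lt1 _ 2)// enorm_ge0.
Qed.

Lemma unit_ball_enorm z : enorm z < 1 -> unit_ball z.
Proof.
by move=> z1; rewrite /unit_ball/= -sqr_enorm expr_lt1// enorm_ge0.
Qed.

Lemma enormZ (t : R) z : 0 <= t -> enorm (t%:C%C *: z) = t * enorm z.
Proof.
by move=> t0; rewrite /enorm sqnormZ sqrtrM ?sqr_ge0// sqrtr_sqr ger0_norm.
Qed.

(** Along the ray through z the derivative of t |-> f(tz) is R f (tz) / t, hence at
    most C g(t|z|) / t.  The factor 1 / t is harmless away from 0: the ray is only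
    followed from a sphere of small radius d on, where t >= d / |z|, and f is
    bounded inside that sphere by continuity at 0.  With 1 / t <= |z| / d the bound
    becomes the derivative of t |-> (C / d) G(t|z|). *)
Lemma radial_growth f (g G : R -> R) (C : R) : holomorphic f -> 0 <= C ->
  (forall u : R, 0 <= u < 1 -> is_derive u (1 : R) G (g u)) ->
  (forall u : R, 0 <= u < 1 -> 0 <= g u) ->
  (forall u : R, 0 <= u < 1 -> 0 <= G u) ->
  (forall z, unit_ball z -> normc (Rderiv f z) <= C * g (enorm z)) ->
  exists2 K : R, 0 <= K &
    forall z, unit_ball z -> normc (f z) <= K * (1 + G (enorm z)).
Proof.
move=> hf C0 dG g0 G0 fC.
have [rho [M [rho0 _ _ fM]]] := holomorphic_near unit_ball0 hf.
pose d := Num.min rho (1 / 2).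
have d0 : 0 < d by rewrite lt_min rho0 divr_gt0.
have d1 : d < 1 by rewrite gt_min [1 / 2 < 1](_ : _ = true) ?orbT//; lra.
have near0 z : enorm z <= d -> normc (f z) <= M.
  move=> zd; rewrite -[z]add0r; apply: fM.
  rewrite (le_lt_trans (rnorm_le_sqrt_sqnorm z))// (le_lt_trans zd)//.
  rewrite (@le_lt_trans _ _ rho) ?ge_min ?lexx//; lra.
have M0 : 0 <= M.
  by apply: le_trans (fM 0 _); rewrite ?normc_ge0 ?rnorm0 ?mulr_gt0.
pose K := M + 2 * (C / d).
have K0 : 0 <= 2 * (C / d) by rewrite mulr_ge0// divr_ge0// ltW.
exists K => [|z z1]; first exact: addr_ge0.
have zl1 := enorm_lt1 z1; have z0 := enorm_ge0 z.
have Gz : 0 <= G (enorm z) by apply: G0; rewrite z0.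
have [zd|zd] := leP (enorm z) d.
  rewrite (le_trans (near0 _ zd))// /K mulrDr mulr1 -addrA lerDl.
  by rewrite addr_ge0// mulr_ge0// addr_ge0.
have zp : 0 < enorm z by exact: lt_trans zd.
(* The parameter at which the ray through z leaves the sphere of radius d. *)
pose a := d / enorm z.
have a0 : 0 < a by exact: divr_gt0.
have a1 : a <= 1 by rewrite ler_pdivrMr// mul1r ltW.
have aE : enorm (a%:C%C *: z) = d by rewrite enormZ ?ltW// divfK// gt_eqF.
have tz t : a <= t <= 1 -> 0 < t /\ t * enorm z < 1.
  move=> /andP[at_ t1]; split; first exact: lt_le_trans at_.
  by rewrite (le_lt_trans _ zl1)// ler_piMl.
have tb t : a <= t <= 1 -> unit_ball (t%:C%C *: z).
  by move=> /tz[t0 tz1]; apply: unit_ball_enorm; rewrite enormZ// ltW.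
have H := @ray_mean_value R _ f 0 z (fun t => C / d * G (t * enorm z))
  (fun t => C / d * (g (t * enorm z) * enorm z)) a 1 a1 _ _ _.
have {}H : normc (f z - f (a%:C%C *: z)) <=
    2 * (C / d * G (enorm z) - C / d * G d).
  have := H; rewrite !add0r (_ : 1%:C%C = 1)// scale1r mul1r {2}/a divfK ?gt_eqF//.
  apply=> t tab; have [t0 t1] := tz t tab.
  - by rewrite add0r; exact/hf/tb.
  - have du : is_derive t (1 : R) (fun t => G (t * enorm z)) (g (t * enorm z) * enorm z).
      have dl : is_derive t (1 : R) ( *%R^~ (enorm z)) (enorm z).
        have := is_deriveZ (f := id) (enorm z) (is_derive_id t (1 : R)).
        rewrite [_ *: 1]mulr1; congr (is_derive _ _ _ _).
        by apply/funext => x /=; rewrite mulrC.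
      have dGt : is_derive (t * enorm z) (1 : R) G (g (t * enorm z)).
        by apply: dG; rewrite t1 mulr_ge0// ltW.
      by have := @is_derive1_comp _ G ( *%R^~ (enorm z)) t _ _ dGt dl.
    exact: is_deriveZ.
  - have df : differentiable f (t%:C%C *: z) by exact/hf/tb.
    have RE : Rderiv f (t%:C%C *: z) = t%:C%C * 'd f (t%:C%C *: z) z.
      by apply: etrans (Rderiv_diff df) _; exact: linearZ.
    have := fC _ (tb _ tab); rewrite RE normcM normc_real.
    rewrite gtr0_norm// (enormZ _ (ltW t0)) => Hf.
    rewrite (add0r (t%:C%C *: z)).
    suff : t * normc ('d f (t%:C%C *: z) z) <=
        t * (C / d * (g (t * enorm z) * enorm z)) by rewrite ler_pM2l.
    apply: le_trans Hf _.
    have gt0 : 0 <= C * g (t * enorm z).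
      by rewrite mulr_ge0// g0// t1 mulr_ge0// ltW.
    have -> : t * (C / d * (g (t * enorm z) * enorm z)) =
      (t * enorm z / d) * (C * g (t * enorm z)) by field; rewrite gt_eqF.
    rewrite ler_peMl// ler_pdivlMr// mul1r.
    by move: tab => /andP[]; rewrite ler_pdivrMr.
have Gd : 0 <= C / d * G d.
  by apply: mulr_ge0; [apply: divr_ge0 => //; exact: ltW|apply: G0; rewrite d1 ltW].
have fa : normc (f (a%:C%C *: z)) <= M by apply: near0; rewrite aE.
rewrite -[f z](subrK (f (a%:C%C *: z))) (le_trans (normcD _ _))//.
rewrite (le_trans (lerD H fa))//.
have MG : 0 <= M * G (enorm z) by exact: mulr_ge0.
rewrite /K; lra.
Qed.

Lemma Rderiv_bounded f C : holomorphic f ->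
  (forall z, unit_ball z -> normc (Rderiv f z) <= C) ->
  exists K, forall z, unit_ball z -> normc (f z) <= K.
Proof.
move=> hf fC.
have C0 : 0 <= C by apply: le_trans (fC 0 unit_ball0); exact: normc_ge0.
have fC1 z : unit_ball z -> normc (Rderiv f z) <= C * 1.
  by rewrite mulr1; exact: fC.
have [K K0 fK] := @radial_growth f (fun=> 1) id C hf C0
  (fun u _ => is_derive_id u (1 : R)) (fun _ _ => ler01)
  (fun u u01 => proj1 (andP u01)) fC1.
exists (K * 2) => z z1; rewrite (le_trans (fK z z1))// ler_wpM2l//.
by have := enorm_lt1 z1; lra.
Qed.

(** A primitive of (1 - u)^(-c) stays bounded up to u = 1, since c < 1. *)
Lemma Rderiv_power_bounded f C (c : R) : holomorphic f -> 0 < c < 1 -> 0 <= C ->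
  (forall z, unit_ball z -> normc (Rderiv f z) <= C * (1 - enorm z) `^ (- c)) ->
  exists K, forall z, unit_ball z -> normc (f z) <= K.
Proof.
move=> hf /andP[c0 c1] C0 fC; have c10 : 0 < 1 - c by rewrite subr_gt0.
pose G (u : R) := (1 - c)^-1 * (1 - (1 - u) `^ (1 - c)).
have G1 (u : R) : 0 <= u < 1 -> (1 - u) `^ (1 - c) <= 1.
  move=> /andP[u0 u1]; have := @ge0_ler_powR R (1 - c) (ltW c10) (1 - u) 1.
  by rewrite powR1; apply; rewrite ?nnegrE; lra.
have dG (u : R) : 0 <= u < 1 -> is_derive u (1 : R) G ((1 - u) `^ (- c)).
  move=> /andP[u0 u1].
  have d1 : is_derive u (1 : R) (fun u : R => 1 - u) (-1).
    have := is_deriveB (is_derive_cst (1 : R) u (1 : R)) (is_derive_id u (1 : R)).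
    by rewrite sub0r.
  have d2 : is_derive (1 - u) (1 : R) (fun x => x `^ (1 - c))
      ((1 - c) * (1 - u) `^ (1 - c - 1)) by apply: is_derive1_powR; lra.
  have d3 := @is_derive1_comp _ (fun x => x `^ (1 - c)) (fun u : R => 1 - u)
    u _ _ d2 d1.
  have d4 := is_deriveB (is_derive_cst (1 : R) u (1 : R)) d3.
  have d5 := is_deriveZ (1 - c)^-1 d4.
  apply: is_derive_eq d5 _.
  rewrite sub0r mulrN1 opprK /= [_ *: _]mulKf ?gt_eqF//; congr (_ `^ _); ring.
have G0 (u : R) : 0 <= u < 1 -> 0 <= G u.
  by move=> /G1 u1; rewrite mulr_ge0 ?invr_ge0 ?subr_ge0// ltW.
have [K K0 fK] := @radial_growth f (fun u => (1 - u) `^ (- c)) G C hf C0 dG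
  (fun u _ => powR_ge0 _ _) G0 fC.
exists (K * (1 + (1 - c)^-1)) => z z1; rewrite (le_trans (fK z z1))// ler_wpM2l//.
rewrite lerD2l ler_piMr ?invr_ge0 ?(ltW c10)// lerBlDr lerDl; exact: powR_ge0.
Qed.

Lemma Rderiv_log_growth f C : holomorphic f -> 0 <= C ->
  (forall z, unit_ball z -> normc (Rderiv f z) <= C * (1 - enorm z)^-1) ->
  exists2 K : R, 0 <= K &
    forall z, unit_ball z -> normc (f z) <= K * (1 - ln (1 - enorm z)).
Proof.
move=> hf C0 fC.
have dG (u : R) : 0 <= u < 1 -> is_derive u (1 : R) (fun u => - ln (1 - u)) (1 - u)^-1.
  move=> /andP[u0 u1].
  have d1 : is_derive u (1 : R) (fun u : R => 1 - u) (-1).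
    have := is_deriveB (is_derive_cst (1 : R) u (1 : R)) (is_derive_id u (1 : R)).
    by rewrite sub0r.
  have d2 : is_derive (1 - u) (1 : R) (@ln R) (1 - u)^-1.
    by apply: is_derive1_ln; lra.
  have d3 := @is_derive1_comp _ (@ln R) (fun u : R => 1 - u) u _ _ d2 d1.
  by apply: is_derive_eq (is_deriveN d3) _; rewrite mulrN1 opprK.
have g0 (u : R) : 0 <= u < 1 -> 0 <= (1 - u : R)^-1.
  by move=> /andP[_ u1]; rewrite invr_ge0 subr_ge0 ltW.
have G0 (u : R) : 0 <= u < 1 -> 0 <= - ln (1 - u : R).
  by move=> /andP[u0 u1]; rewrite oppr_ge0 ln_le0//; lra.
have [K K0 fK] := radial_growth hf C0 dG g0 G0 fC.
by exists K.
Qed.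

End radial_growth.

(** * Growth of Lipschitz functions and pointwise multipliers *)

Section integral_domination.
Import HBNNSimple.
Local Open Scope ereal_scope.

(** The integral of a nonnegative function is a supremum over the simple functions
    below it, and h |-> K^-1 h maps those below f to simple functions below g.  This
    comparison of suprema holds for all functions, measurable or not. *)
Lemma ge0_integral_le_scale d (T : measurableType d) (R : realType)
    (mu : {measure set T -> \bar R}) (D : set T) (f g : T -> R) (K : R) :
  (0 < K)%R -> (forall x, D x -> (0 <= f x)%R) ->
  (forall x, D x -> (f x <= K * g x)%R) ->
  \int[mu]_(x in D) (f x)%:E <= K%:E * \int[mu]_(x in D) (g x)%:E.
Proof.
move=> K0 f0 fg.
have g0 x : D x -> (0 <= g x)%R.
  by move=> Dx; rewrite -(pmulr_rge0 _ K0) (le_trans (f0 x Dx))// fg.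
rewrite ge0_integralE => [|x Dx]; last by rewrite lee_fin f0.
apply: ge_ereal_sup => /= _ [h /= hf <-].
have Ki0 : (0 <= K^-1)%R by rewrite invr_ge0 ltW.
have -> : sintegral mu h = K%:E * sintegral mu (scale_nnsfun h Ki0).
  by rewrite sintegralrM muleA -EFinM divff ?gt_eqF// mul1e.
rewrite lee_pmul2l// ge0_integralE => [|x Dx]; last by rewrite lee_fin g0.
apply: ereal_sup_ubound => /=; exists (scale_nnsfun h Ki0) => //= x.
have := hf x; rewrite /patch; case: ifPn => [/set_mem Dx|_].
  by rewrite !lee_fin ler_pdivrMl// => /le_trans; apply; exact: fg.
by rewrite !lee_fin => hx; rewrite mulr_ge0_le0.
Qed.

End integral_domination.

Section multipliers.
Context {R : realType} {n : nat}.
Implicit Types (z : 'rV[R[i]]_n) (f phi : 'rV[R[i]]_n -> R[i]).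

Lemma Nsup_le_scale (q s K : R) (g1 g2 : 'rV[R[i]]_n -> R) : 0 < K ->
  (forall z, unit_ball z -> 0 <= g1 z) ->
  (forall z, unit_ball z -> g1 z <= K * g2 z) ->
  (Nsup q s g1 <= K%:E * Nsup q s g2)%E.
Proof.
move=> K0 g10 g12; apply: ge_ereal_sup => _ [a a1 <-].
apply: (@le_trans _ _ (K%:E * integral_dlambda (fun z => (g2 z *
    (1 - sqnorm z) `^ q * (1 - sqnorm (Phi a z)) `^ (n%:R * s))%R))%E); last first.
  by rewrite lee_pmul2l//; apply: ereal_sup_ubound; exists a.
have w0 z : unit_ball z -> 0 <= (1 - sqnorm z) ^+ n.+1.
  by move=> z1; rewrite exprn_ge0// subr_ge0 ltW.
apply: ge0_integral_le_scale => // z z1.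
  by rewrite divr_ge0 ?w0// !mulr_ge0 ?powR_ge0// g10.
rewrite !mulrA; apply: ler_wpM2r; first by rewrite invr_ge0 w0.
apply: ler_wpM2r; first exact: powR_ge0.
by apply: ler_wpM2r; [exact: powR_ge0|exact: g12].
Qed.

Lemma spaceN_mul_dominated (p q s K : R) (W : 'rV[R[i]]_n -> R) phi f :
  0 <= p -> holomorphic phi -> holomorphic f -> 0 <= K ->
  (forall z, unit_ball z -> 0 <= W z) ->
  (forall z, unit_ball z -> normc (f z) <= K * W z) ->
  (Nsup q s (fun z => (normc (phi z) `^ p * W z `^ p)%R) < +oo)%E ->
  spaceN p q s (fun z => phi z * f z).
Proof.
move=> p0 hphi hf K0 W0 fW Noo; split.
  by move=> z z1; apply: differentiableM; [exact: hphi|exact: hf].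
pose K' := K + 1; have K'0 : 0 < K' by rewrite ltr_wpDl.
have Kp : 0 < K' `^ p by rewrite powR_gt0.
apply: le_lt_trans (Nsup_le_scale q s Kp _ _) _; last 1 first.
- by apply: lte_mul_pinfty Noo; rewrite ?lee_fin ?ltW.
- by move=> z _; exact: powR_ge0.
- move=> z z1; rewrite normcM powRM ?normc_ge0// mulrCA.
  apply: ler_wpM2l; first exact: powR_ge0.
  rewrite -powRM ?W0 ?(ltW K'0)//; apply: ge0_ler_powR => //; rewrite ?nnegrE.
  + exact: normc_ge0.
  + by rewrite mulr_ge0 ?W0// ltW.
  + by rewrite (le_trans (fW z z1))// ler_wpM2r ?W0// lerDl.
Qed.

Lemma Rderiv_cst (c : R[i]) : Rderiv (fun=> c) = (fun=> 0) :> ('rV[R[i]]_n -> R[i]).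
Proof.
apply/funext => z; rewrite /Rderiv big1// => k _.
by rewrite (_ : 'D_('e_k) _ _ = 0) ?mulr0//; exact: derive_cst.
Qed.

(** As [0 <= beta], the order is at least 1 and the constant is killed by R. *)
Lemma one_in_spaceLip (beta : R) : 0 <= beta ->
  spaceLip beta (fun=> 1 : R[i]) (n := n).
Proof.
move=> b0; split; first by move=> z _; exact: differentiable_cst.
have k0 : (0 < Lip_order beta)%N.
  rewrite /Lip_order; case: ex_minnP => k bk _.
  by rewrite -(ltr_nat R) (le_lt_trans b0).
apply: (@le_lt_trans _ _ ((normc (1 : R[i]))%:E + 0)%E); last first.
  by rewrite adde0 ltry.
apply: leeD2l; apply: ge_ereal_sup => _ [z _ <-].
have -> : Lip_order beta = (Lip_order beta).-1.+1 by rewrite prednK.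
rewrite iterSr Rderiv_cst (_ : iter _ Rderiv _ = fun=> 0).
  by rewrite (normc0 R) mulr0.
by elim: (_.-1) => // j IH; rewrite iterS IH Rderiv_cst.
Qed.

(** Hence the exponent [Lip_order beta - beta] lies in ]0, 1]. *)
Lemma Lip_orderP (beta : R) : 0 <= beta -> exists j,
  [/\ Lip_order beta = j.+1, j%:R <= beta & beta < j.+1%:R].
Proof.
move=> b0; rewrite /Lip_order; case: ex_minnP => -[|j] bk kmin.
  by move: bk; rewrite ltNge b0.
exists j; split => //; rewrite leNgt; apply/negP => /kmin.
by rewrite ltnn.
Qed.

(** Passing from 1 - |z|^2 to 1 - |z| only weakens the estimate, and gives a
    function of |z| with an explicit primitive. *)
Lemma spaceLip_growth (beta : R) f : spaceLip beta f -> 0 <= beta ->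
  exists2 C : R, 0 <= C & forall z, unit_ball z ->
    normc (iter (Lip_order beta) Rderiv f z) <=
    C * (1 - enorm z) `^ (- ((Lip_order beta)%:R - beta)).
Proof.
move=> [hf foo] b0; set k := Lip_order beta; pose c := k%:R - beta.
have c0 : 0 < c.
  by rewrite subr_gt0 /k; have [j [-> _ ->]] := Lip_orderP b0.
set S := ereal_sup _ in foo.
have S0 z : unit_ball z ->
    (((1 - sqnorm z) `^ c * normc (iter k Rderiv f z))%:E <= S)%E.
  by move=> z1; apply: ereal_sup_ubound; exists z.
have Sge0 : (0 <= S)%E.
  apply: le_trans (S0 _ unit_ball0); rewrite lee_fin mulr_ge0 ?powR_ge0//.
  exact: normc_ge0.
have Sfin : S \is a fin_num.
  rewrite ge0_fin_numE//; apply: le_lt_trans foo.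
  by rewrite leeDr// lee_fin normc_ge0.
exists (fine S) => [|z z1]; first exact: fine_ge0.
have := S0 z z1; rewrite -(fineK Sfin) lee_fin => H.
have e1 := enorm_lt1 z1; have e0 := enorm_ge0 z.
have s1 : 0 < 1 - sqnorm z by rewrite subr_gt0.
have p1 : 0 < (1 - enorm z) `^ c by rewrite powR_gt0// subr_gt0.
rewrite powRN ler_pdivlMr// mulrC (le_trans _ H)//.
apply: ler_wpM2r; first exact: normc_ge0.
apply: (ge0_ler_powR (ltW c0)); rewrite ?nnegrE ?subr_ge0 ?(ltW e1)//.
  exact: ltW.
by rewrite lerD2l lerN2 -sqr_enorm expr2 ler_piMl// ltW.
Qed.

Lemma iter_Rderiv_bounded f k C : holomorphic f ->
  (forall z, unit_ball z -> normc (iter k Rderiv f z) <= C) ->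
  exists K, forall z, unit_ball z -> normc (f z) <= K.
Proof.
move=> hf; elim: k C => [|k IH] C fC; first by exists C.
have [K fK] := Rderiv_bounded (iter_Rderiv_holomorphic k hf) fC.
exact: IH fK.
Qed.

(** With y = x^(-1/2) >= 1: 1 <= y and - ln x = 2 ln y < 2 y. *)
Lemma log_le_invsqrt (x : R) : 0 < x <= 1 -> 1 - ln x <= 3 * x `^ (- (1 / 2)).
Proof.
move=> /andP[x0 x1]; have y0 : 0 < x `^ (- (1 / 2)) by rewrite powR_gt0.
have lx : ln x <= 0 by exact: ln_le0.
have ly := ln_powR x (- (1 / 2)).
have y1 : 1 <= x `^ (- (1 / 2)).
  rewrite leNgt; apply/negP => y1.
  have : ln (x `^ (- (1 / 2))) < 0 by apply: ln_lt0; rewrite y0.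
  rewrite ly; lra.
have := ln_sublinear y0; rewrite ly; lra.
Qed.

(** Write the order as j + 1.  If j < beta then the exponent j + 1 - beta is less
    than 1 and R^j f is bounded.  If j = beta then j > 0 and R^j f has logarithmic
    growth, so that R^(j-1) f is bounded. *)
Lemma spaceLip_bounded (beta : R) f : 0 < beta -> spaceLip beta f ->
  exists K, forall z, unit_ball z -> normc (f z) <= K.
Proof.
move=> b0 Lf; have [C C0 fC] := spaceLip_growth Lf (ltW b0).
have [j [kE jb bj]] := Lip_orderP (ltW b0); rewrite {}kE in fC.
have hf := Lf.1; have hj i := iter_Rderiv_holomorphic i hf.
have [jltb|jeb] : j%:R < beta \/ j%:R = beta.
  by move: jb; rewrite le_eqVlt => /predU1P; tauto.
  have c01 : 0 < j.+1%:R - beta < 1.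
    by rewrite subr_gt0 bj ltrBlDr -[ltLHS]natr1 addrC ltrD2l.
  have [K fK] := Rderiv_power_bounded (hj j) c01 C0 fC.
  exact: iter_Rderiv_bounded fK.
rewrite -jeb in b0 fC; case: j b0 fC {jb bj jeb} => [|i] b0 fC.
  by rewrite ltxx in b0.
have fC' z : unit_ball z ->
    normc (Rderiv (iter i.+1 Rderiv f) z) <= C * (1 - enorm z)^-1.
  move=> z1; rewrite (le_trans (fC z z1))// -natr1 addrAC subrr add0r.
  by rewrite powR_inv1// subr_ge0 ltW// enorm_lt1.
have [K K0 fK] := Rderiv_log_growth (hj i.+1) C0 fC'.
have half01 : 0 < (1 / 2 : R) < 1.
  by apply/andP; split; [exact: divr_gt0|exact: half_lt ltr01].
have K3 : 0 <= K * 3 by rewrite mulr_ge0.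
have fK' z : unit_ball z ->
    normc (Rderiv (iter i Rderiv f) z) <= K * 3 * (1 - enorm z) `^ (- (1 / 2)).
  move=> z1; rewrite (le_trans (fK z z1))// -mulrA ler_wpM2l//.
  apply: log_le_invsqrt; rewrite subr_gt0 enorm_lt1//= gerBl enorm_ge0//.
have [K' fK''] := Rderiv_power_bounded (hj i) half01 K3 fK'.
exact: iter_Rderiv_bounded fK''.
Qed.

(** The order is 1 and the exponent is 1.  As 1 - |z|^2 <= 2 (1 - |z|), the quantity
    - ln (1 - |z|) is at most ln (2 / (1 - |z|^2)), which is also at least
    ln 2. *)
Lemma spaceLip0_log_growth f : spaceLip (0 : R) f ->
  exists2 K : R, 0 <= K & forall z, unit_ball z ->
    normc (f z) <= K * ln (2 / (1 - sqnorm z)).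
Proof.
move=> Lf; have [C C0 fC] := spaceLip_growth Lf (lexx 0).
have [j [kE jb bj]] := Lip_orderP (lexx (0 : R)).
have j0 : j = 0%N by apply/eqP; rewrite -(@eqr_nat R) eq_le jb ler0n.
rewrite {}kE {}j0 subr0 in fC.
have fC' z : unit_ball z -> normc (Rderiv f z) <= C * (1 - enorm z)^-1.
  move=> z1; rewrite (le_trans (fC z z1))//.
  by rewrite powR_inv1// subr_ge0 ltW// enorm_lt1.
have [K K0 fK] := Rderiv_log_growth Lf.1 C0 fC'.
have ln2 : 0 < ln 2 :> R by apply: ln_gt0; rewrite ltr1n.
exists (K * ((ln 2)^-1 + 1)) => [|z z1].
  by rewrite mulr_ge0// addr_ge0// invr_ge0 ltW.
rewrite (le_trans (fK z z1))// -mulrA ler_wpM2l// mulrDl mul1r.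
have e1 := enorm_lt1 z1; have e0 := enorm_ge0 z.
have s1 : 0 < 1 - sqnorm z by rewrite subr_gt0.
have s0 := sqnorm_ge0 z.
apply: lerD.
  rewrite ler_pdivlMl// mulr1 ler_ln ?posrE ?divr_gt0//.
  by rewrite ler_pdivlMr// ler_piMr//; lra.
rewrite -lnV ?posrE ?subr_gt0// ler_ln ?posrE ?divr_gt0 ?invr_gt0 ?subr_gt0//.
rewrite ler_pdivlMr// ler_pdivrMl ?subr_gt0// -sqr_enorm.
nra.
Qed.

End multipliers.

(** * The multiplier theorem *)

Theorem theorem8p18 (R : realType) (n : nat) (n_gt0 : (0 < n)%N)
    (p q s beta : R) (p_ge1 : 1 <= p) (q_gt0 : 0 < q)
    (s_gt : Num.max 0 (1 - q / n%:R) < s) :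
  (0 < beta ->
     multipliers (spaceLip beta) (spaceN p q s) = spaceN p q s
       :> set ('rV[R[i]]_n -> R[i])) /\
  (beta = 0 ->
     multipliers (spaceLip beta) (spaceN p q s) `<=` (spaceN p q s
       : set ('rV[R[i]]_n -> R[i])) /\
     forall phi : 'rV[R[i]]_n -> R[i], holomorphic phi ->
       (Nsup q s (fun z =>
          (normc (phi z) `^ p * (ln (2 / (1 - sqnorm z))) `^ p)%R) < +oo)%E ->
       multipliers (spaceLip beta) (spaceN p q s) phi).
Proof.
have p0 : 0 <= p by exact: le_trans ler01 p_ge1.
have sub : 0 <= beta ->
    multipliers (spaceLip beta) (spaceN p q s) `<=` (spaceN p q s
    : set ('rV[R[i]]_n -> R[i])).
  move=> b0 phi [_ /(_ _ (one_in_spaceLip b0))].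
  by rewrite (_ : (fun z => phi z * 1) = phi)//; apply/funext => z; rewrite mulr1.
split=> [b0|b0].
  apply/seteqP; split=> [|phi [hphi Noo]]; first exact: sub (ltW b0).
  split=> [|f Lf]; first exact: hphi.
  have [K fK] := spaceLip_bounded b0 Lf.
  have K0 : 0 <= K by exact: le_trans (normc_ge0 _) (fK _ unit_ball0).
  apply: (@spaceN_mul_dominated _ _ p q s K (fun=> 1)) p0 hphi _ K0 _ _ _.
  - exact: Lf.1.
  - by move=> z _; exact: ler01.
  - by move=> z z1; rewrite mulr1; exact: fK.
  - suff -> : (fun z => normc (phi z) `^ p * 1 `^ p) = (fun z => normc (phi z) `^ p).
      exact: Noo.
    by apply/funext => z; rewrite powR1 mulr1.
split=> [|phi hphi Noo]; first by apply: sub; rewrite b0.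
rewrite b0; split=> [|f Lf]; first exact: hphi.
have [K K0 fK] := spaceLip0_log_growth Lf.
apply: (spaceN_mul_dominated p0 hphi Lf.1 K0 _ fK Noo).
move=> z; rewrite /unit_ball/= => z1; apply: ln_ge0.
have s1 : 0 < 1 - sqnorm z by rewrite subr_gt0.
by rewrite ler_pdivlMr// mul1r; have := sqnorm_ge0 z; lra.
Qed.
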